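(* Let $n\ge 1$ and let $\mathbf r=\{r_{ij}\}_{0\le i\le j\le n}$ be a set of rank conditions that occur. Then there is an (explicit) injective map $W_{\min}(\mathbf r)\hookrightarrow \mathcal{RC}(v(\mathbf r))$, $W\mapsto D$, such that for every $W\in W_{\min}(\mathbf r)$ its image $D$ maps to $W$.
   Context: Rank conditions: nonnegative integers $r_{ij}$, $0\le i\le j\le n$, with the convention $r_{ij}=0$ if $i$ or $j$ is not in $[0,n]$. They occur means: $r_{ij}\le\min(r_{i,j-1},r_{i+1,j})$ for $i<j$, and the lace array $s_{ij}(\mathbf r):=r_{ij}-r_{i-1,j}-r_{i,j+1}+r_{i-1,j+1}$ is $\ge 0$ for all $0\le i\le j\le n$. Put $d=r_{00}+r_{11}+\cdots+r_{nn}$ and $d(\mathbf r)=\sum_{0\le i<j\le n}(r_{i,j-1}-r_{ij})(r_{i+1,j}-r_{ij})$. Lacing diagrams: a lacing diagram is a graph whose vertices are arranged in columns $0,1,\dots,n$, column $i$ having $r_{ii}$ vertices numbered $1,\dots,r_{ii}$ from the bottom; edges join vertices in consecutive columns only, and no two edges between the same two consecutive columns share a vertex. An $(i,j)$-lace is a connected component starting in column $i$ and ending in column $j$. $W$ is a lacing diagram for $\mathbf r$ if for all $i\le j$ the number of $(i,j)$-laces equals $s_{ij}(\mathbf r)$. A lacing diagram is identified with $W=(w_1,\dots,w_n)$, where $w_k$ is the $r_{k-1,k-1}\times r_{kk}$ $(0,1)$-matrix (a partial permutation matrix) with a $1$ in position $(\alpha,\beta)$ iff an edge joins the $\alpha$-th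 vertex of column $k-1$ to the $\beta$-th vertex of column $k$. For an $a\times b$ partial permutation matrix $\rho$, its minimal length embedding $\tilde\rho\in S_{a+b}$ is the $(a+b)\times(a+b)$ permutation matrix having $\rho$ as its northwest $a\times b$ submatrix, where in columns $b+1,\dots,a+b$ one places $1$'s in those of the top $a$ rows that have no $1$ in $\rho$, proceeding from northwest to southeast, and in rows $a+1,\dots,a+b$ one places $1$'s in those columns not yet containing a $1$, proceeding northwest to southeast. Set $\ell(\rho)=\ell(\tilde\rho)$ (Coxeter length = number of inversions) and $\ell(W)=\sum_k\ell(w_k)$. $W_{\min}(\mathbf r)$ is the set of lacing diagrams $W$ for $\mathbf r$ with $\ell(W)=d(\mathbf r)$. Zelevinsky permutation: the graph of $w\in S_d$ is the set of points $(i,w(i))$ in the $d\times d$ grid (row $i$ from the top, column $w(i)$ from the left). Partition the $d\times d$ grid into blocks $M_{ij}$, $0\le i,j\le n$, in block-matrix fashion, where $M_{ij}$ has $r_{ii}$ rows and $r_{n-j,n-j}$ columns. Starting with $M_{nn}$ and proceeding right to left and bottom to top through the blocks, place $s_{n-j,i}(\mathbf r)$ points into $M_{ij}$ (zero if $n-j>i$), as far southeast as possible, so that no two points placed lie in the same row or column of the grid. Then fill the remaining empty rows and columns by placing points contiguously on the main diagonal of the super-antidiagonal blocks $M_{i,n-i-1}$, $i=0,\dots,n-1$. The result is the graph of a permutation $v(\mathbf r)\in S_d$, the Zelevinsky permutation. Pipe dreams: a pipe dream is a tiling of the $d\times d$ grid (box $(i,j)$ in row $i$, column $j$) in which each box contains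 a cross or an elbow joint, producing a network of pipes. A pipe dream for $w\in S_d$ is one with no crosses in boxes $(i,j)$ with $i+j>d$ and in which the pipe entering at the left of row $i$ exits at the top of column $w(i)$. $\mathcal{RC}(w)$ is the set of pipe dreams for $w$ in which any two pipes cross at most once (RC-graphs). Maps to: with the convention $r_{kk}=0$ for $k<0$, a pipe dream $R$ maps to the lacing diagram $W=(w_1,\dots,w_n)$ if for all $1\le k\le n$, $1\le s\le r_{k-1,k-1}$, $1\le t\le r_{kk}$: some pipe of $R$ passes through the top edge of the box $(r_{00}+\cdots+r_{k-2,k-2}+1,\; r_{nn}+r_{n-1,n-1}+\cdots+r_{k-1,k-1}-s+1)$ and through the bottom edge of the box $(r_{00}+\cdots+r_{k-1,k-1},\; r_{nn}+r_{n-1,n-1}+\cdots+r_{kk}-t+1)$ if and only if the $(s,t)$ entry of $w_k$ equals $1$. *)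

(* Defs.v *)
From mathcomp Require Import all_boot all_order all_algebra all_fingroup zify.

Set Implicit Arguments.
Unset Strict Implicit.
Unset Printing Implicit Defensive.

Import Order.TTheory GRing.Theory Num.Theory.

(* Only the values r i j with i <= j <= n are data; [rank] implements the
   convention that r_ij = 0 as soon as i or j leaves [0, n]. *)
Definition rank (n : nat) (r : nat -> nat -> nat) (i j : int) : int :=
  match i, j with
  | Posz i', Posz j' => if (i' <= n) && (j' <= n) then Posz (r i' j') else 0%R
  | _, _ => 0%R
  end.

Definition lace_array (n : nat) (r : nat -> nat -> nat) (i j : nat) : int :=
  (rank n r i j - rank n r (i%:Z - 1) j - rank n r i (j%:Z + 1)
   + rank n r (i%:Z - 1) (j%:Z + 1))%R.

Definition occur (n : nat) (r : nat -> nat -> nat) : Prop :=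
  (forall i j, i < j <= n -> r i j <= minn (r i j.-1) (r i.+1 j)) /\
  (forall i j, i <= j <= n -> (0 <= lace_array n r i j)%R).

Definition total_dim (n : nat) (r : nat -> nat -> nat) : nat :=
  \sum_(k < n.+1) r k k.

Definition expected_codim (n : nat) (r : nat -> nat -> nat) : int :=
  (\sum_(i < n.+1) \sum_(j < n.+1 | (i < j)%N)
     ((r i j.-1)%:Z - (r i j)%:Z) * ((r i.+1 j)%:Z - (r i j)%:Z))%R.

(* The permutation w of {0, ..., d-1} whose graph {(i, w i)} is contained in
   the list of points [pts] (a pair is a row and a column, both counted from
   0). The default value is irrelevant: see [perm_of_pointsP], [embeddingP]
   and [zelevinskyP]. *)
Definition perm_of_points (d : nat) (pts : seq (nat * nat)) : 'S_d :=
  odflt 1%g [pick w : 'S_d | [forall i, (val i, val (w i)) \in pts]].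

Definition free_rows (pts : seq (nat * nat)) (rows : seq nat) : seq nat :=
  [seq p <- rows | p \notin unzip1 pts].

Definition free_cols (pts : seq (nat * nat)) (cols : seq nat) : seq nat :=
  [seq q <- cols | q \notin unzip2 pts].

Definition inversions (d : nat) (w : 'S_d) : nat :=
  #|[set p : 'I_d * 'I_d | (p.1 < p.2) && (w p.2 < w p.1)]|.

Definition partial_perm (a b : nat) (rho : 'M[bool]_(a, b)) : bool :=
  [forall i, #|[set j | rho i j]| <= 1] &&
  [forall j, #|[set i | rho i j]| <= 1].

Definition mx_points (a b : nat) (rho : 'M[bool]_(a, b)) : seq (nat * nat) :=
  [seq (val p.1, val p.2) | p <- enum {: 'I_a * 'I_b} & rho p.1 p.2].

(* [zip] truncates to the shorter list. *)
Definition embedding_points (a b : nat) (rho : 'M[bool]_(a, b)) :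
    seq (nat * nat) :=
  let top := mx_points rho ++ zip (free_rows (mx_points rho) (iota 0 a))
                                  (iota b a) in
  top ++ zip (iota a b) (free_cols top (iota 0 (a + b))).

Definition embedding (a b : nat) (rho : 'M[bool]_(a, b)) : 'S_(a + b) :=
  perm_of_points (a + b) (embedding_points rho).

(* The component of index k : 'I_n is the matrix w_(k+1), so that the 1-based
   vertices alpha and beta are here the ordinals alpha - 1 and beta - 1. *)
Definition lacing (n : nat) (r : nat -> nat -> nat) : Type :=
  {dffun forall k : 'I_n, 'M[bool]_(r k k, r k.+1 k.+1)}.

Definition vertex (n : nat) (r : nat -> nat -> nat) : Type :=
  {k : 'I_n.+1 & 'I_(r k k)}.

Definition lacing_edge (n : nat) (r : nat -> nat -> nat) (W : lacing n r) :
    rel (vertex n r) :=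
  fun x y => [exists k : 'I_n, exists a : 'I_(r k k),
    exists b : 'I_(r k.+1 k.+1),
    [&& W k a b, tag x == k :> nat, tagged x == a :> nat,
        tag y == k.+1 :> nat & tagged y == b :> nat]].

Definition components (n : nat) (r : nat -> nat -> nat) (W : lacing n r) :
    {set {set vertex n r}} :=
  equivalence_partition
    (connect (fun x y => lacing_edge W x y || lacing_edge W y x))
    [set: vertex n r].

Definition laces (n : nat) (r : nat -> nat -> nat) (W : lacing n r)
    (i j : nat) : {set {set vertex n r}} :=
  [set C in components W |
    [&& [exists x in C, tag x == i :> nat],
        [exists y in C, tag y == j :> nat] &
        [forall x in C, i <= tag x <= j]]].

Definition lacing_diagram_for (n : nat) (r : nat -> nat -> nat)
    (W : lacing n r) : bool :=
  [forall k, partial_perm (W k)] &&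
  [forall i : 'I_n.+1, forall j : 'I_n.+1,
     (i <= j) ==> (Posz #|laces W i j| == lace_array n r i j)].

Definition lacing_length (n : nat) (r : nat -> nat -> nat) (W : lacing n r) :
    nat :=
  \sum_(k < n) inversions (embedding (W k)).

Definition Wmin (n : nat) (r : nat -> nat -> nat) : {set lacing n r} :=
  [set W | lacing_diagram_for W &&
           (Posz (lacing_length W) == expected_codim n r)].

(* First row of the blocks M_ij (j varying), first column of the blocks M_ij
   (i varying), counted from 0. *)
Definition block_row (r : nat -> nat -> nat) (i : nat) : nat :=
  \sum_(k < i) r k k.

Definition block_col (n : nat) (r : nat -> nat -> nat) (j : nat) : nat :=
  \sum_(k < j) r (n - k) (n - k).

Definition block_points (n : nat) (r : nat -> nat -> nat) (i j : nat) : nat :=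
  if n - j <= i then `|lace_array n r (n - j) i|%N else 0.

(* The southeasternmost placement uses the last free rows and the last free
   columns of the block, from southeast to northwest. *)
Definition fill_block (n : nat) (r : nat -> nat -> nat)
    (pts : seq (nat * nat)) (ij : nat * nat) : seq (nat * nat) :=
  let: (i, j) := ij in
  let rows := free_rows pts (iota (block_row r i) (r i i)) in
  let cols := free_cols pts (iota (block_col n r j) (r (n - j) (n - j))) in
  let m := block_points n r i j in
  pts ++ zip (take m (rev rows)) (take m (rev cols)).

Definition southeast_points (n : nat) (r : nat -> nat -> nat) :
    seq (nat * nat) :=
  foldl (fill_block n r) [::]
    [seq (i, j) | i <- rev (iota 0 n.+1), j <- rev (iota 0 n.+1)].

(* The boxes of the main diagonal of the block M_(i, n-i-1) whose row and
   column are both free. *)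
Definition diagonal_points (n : nat) (r : nat -> nat -> nat)
    (pts : seq (nat * nat)) (i : nat) : seq (nat * nat) :=
  [seq p <- [seq (block_row r i + t, block_col n r (n - i.+1) + t)
            | t <- iota 0 (minn (r i i) (r i.+1 i.+1))]
  | (p.1 \notin unzip1 pts) && (p.2 \notin unzip2 pts)].

Definition zelevinsky_points (n : nat) (r : nat -> nat -> nat) :
    seq (nat * nat) :=
  let pts := southeast_points n r in
  pts ++ flatten [seq diagonal_points n r pts i | i <- iota 0 n].

Definition zelevinsky (n : nat) (r : nat -> nat -> nat) :
    'S_(total_dim n r) :=
  perm_of_points (total_dim n r) (zelevinsky_points n r).

(* [true] is a cross, [false] an elbow joint; rows and columns are counted
   from 0. *)
Definition pipe_dream (d : nat) : Type := 'M[bool]_d.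

(* The edges of the boxes of the d x d grid: [inl (p, q)] is the horizontal
   edge on top of the box (p, q), or on the bottom of the grid if p = d;
   [inr (p, q)] is the vertical edge at the left of the box (p, q), or at the
   right of the grid if q = d. *)
Definition grid_edge (d : nat) : Type :=
  ('I_d.+1 * 'I_d + 'I_d * 'I_d.+1)%type.

Definition top_edge (d : nat) (b : 'I_d * 'I_d) : grid_edge d :=
  inl (widen_ord (leqnSn d) b.1, b.2).
Definition bottom_edge (d : nat) (b : 'I_d * 'I_d) : grid_edge d :=
  inl (lift ord0 b.1, b.2).
Definition left_edge (d : nat) (b : 'I_d * 'I_d) : grid_edge d :=
  inr (b.1, widen_ord (leqnSn d) b.2).
Definition right_edge (d : nat) (b : 'I_d * 'I_d) : grid_edge d :=
  inr (b.1, lift ord0 b.2).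

(* A cross joins left to right and bottom to top; an elbow joint joins left to
   top and bottom to right. *)
Definition pipe_step (d : nat) (D : pipe_dream d) : rel (grid_edge d) :=
  fun e f => [exists b : 'I_d * 'I_d,
    (e == left_edge b) &&
      (f == if D b.1 b.2 then right_edge b else top_edge b)
    || (e == bottom_edge b) &&
      (f == if D b.1 b.2 then top_edge b else right_edge b)].

(* Pipes enter the grid at its left side or at its bottom. *)
Definition left_entry (d : nat) (p : 'I_d) : grid_edge d := inr (p, ord0).
Definition bottom_entry (d : nat) (q : 'I_d) : grid_edge d := inl (ord_max, q).
Definition top_exit (d : nat) (q : 'I_d) : grid_edge d := inl (ord0, q).

Definition pipe (d : nat) (D : pipe_dream d) (e : grid_edge d) :
    {set grid_edge d} := [set f | connect (pipe_step D) e f].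

Definition pipes (d : nat) (D : pipe_dream d) : {set {set grid_edge d}} :=
  [set pipe D (left_entry p) | p : 'I_d]
    :|: [set pipe D (bottom_entry q) | q : 'I_d].

Definition crossings (d : nat) (D : pipe_dream d) (P Q : {set grid_edge d}) :
    {set 'I_d * 'I_d} :=
  [set b : 'I_d * 'I_d | D b.1 b.2 &&
    ((left_edge b \in P) && (bottom_edge b \in Q)
     || (left_edge b \in Q) && (bottom_edge b \in P))].

(* In the first condition the 0-based row p and column q are shifted to the
   usual 1-based coordinates. *)
Definition pipe_dream_for (d : nat) (w : 'S_d) (D : pipe_dream d) : bool :=
  [forall p : 'I_d, forall q : 'I_d, (d < p.+1 + q.+1) ==> ~~ D p q] &&
  [forall p : 'I_d, top_exit (w p) \in pipe D (left_entry p)].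

Definition RC (d : nat) (w : 'S_d) : {set pipe_dream d} :=
  [set D | pipe_dream_for w D &&
    [forall P in pipes D, forall Q in pipes D,
       (P != Q) ==> (#|crossings D P Q| <= 1)]].

(* The box [b] in row i and column j of the grid, i and j counted from 1. *)
Definition is_box (d : nat) (b : 'I_d * 'I_d) (i j : nat) : bool :=
  (b.1.+1 == i) && (b.2.+1 == j).

(* With k' = k + 1, s' = s + 1 and t' = t + 1 the 1-based indices, the two
   boxes are (r_00 + ... + r_(k'-2,k'-2) + 1, r_nn + ... + r_(k'-1,k'-1) - s' + 1)
   and (r_00 + ... + r_(k'-1,k'-1), r_nn + ... + r_(k',k') - t' + 1). *)
Definition maps_to (n : nat) (r : nat -> nat -> nat)
    (D : pipe_dream (total_dim n r)) (W : lacing n r) : Prop :=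
  forall (k : 'I_n) (s : 'I_(r k k)) (t : 'I_(r k.+1 k.+1)),
    (exists2 P, P \in pipes D & exists b c : 'I_(total_dim n r) * 'I_(total_dim n r),
       [/\ is_box b (\sum_(0 <= i < k) r i i + 1)
                    (\sum_(k <= i < n.+1) r i i - s.+1 + 1),
           is_box c (\sum_(0 <= i < k.+1) r i i)
                    (\sum_(k.+1 <= i < n.+1) r i i - t.+1 + 1),
           top_edge b \in P & bottom_edge c \in P])
    <-> W k s t.

Lemma perm_of_pointsP d (pts : seq (nat * nat)) :
    uniq (unzip1 pts) -> uniq (unzip2 pts) ->
    {in pts, forall p, (p.1 < d) && (p.2 < d)} -> d <= size pts ->
  perm_eq [seq (val i, val (perm_of_points d pts i)) | i : 'I_d] pts.
Proof.
move=> u1 u2 bd sz.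
have inj1 p q : p \in pts -> q \in pts -> p.1 = q.1 -> p = q.
  move=> pP qP e; apply/eqP; rewrite -(nth_index (0, 0) pP) -(nth_index (0, 0) qP).
  rewrite nth_uniq ?index_mem ?(map_uniq u1) //.
  rewrite -(nth_uniq 0 _ _ u1) ?size_map ?index_mem //.
  by rewrite !(nth_map (0, 0)) ?index_mem // !nth_index // e.
have inj2 p q : p \in pts -> q \in pts -> p.2 = q.2 -> p = q.
  move=> pP qP e; apply/eqP; rewrite -(nth_index (0, 0) pP) -(nth_index (0, 0) qP).
  rewrite nth_uniq ?index_mem ?(map_uniq u1) //.
  rewrite -(nth_uniq 0 _ _ u2) ?size_map ?index_mem //.
  by rewrite !(nth_map (0, 0)) ?index_mem // !nth_index // e.
have sub1 : {subset unzip1 pts <= iota 0 d}.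
  by move=> _ /mapP[p pP ->]; rewrite mem_iota /=; case/andP: (bd _ pP).
have le1 : size (iota 0 d) <= size (unzip1 pts) by rewrite size_iota size_map.
have [_ eq1] := uniq_min_size u1 sub1 le1.
have ex (i : 'I_d) : exists j : 'I_d, (val i, val j) \in pts.
  have : val i \in unzip1 pts by rewrite eq1 mem_iota /=.
  case/mapP => -[a b] abP /= ->.
  have /andP[_ /= bd'] := bd _ abP.
  by exists (Ordinal bd').
pose f i := xchoose (ex i).
have fP i : (val i, val (f i)) \in pts by exact: (xchooseP (ex i)).
have f_inj : injective f.
  by move=> i j e; apply: val_inj; have [] := inj2 _ _ (fP i) (fP j) (congr1 val e).
have wP (i : 'I_d) : (val i, val (perm_of_points d pts i)) \in pts.
  rewrite /perm_of_points; case: pickP => [w /forallP //|/(_ (perm f_inj)) /negP[]].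
  by apply/forallP => k; rewrite permE.
have us : uniq [seq (val i, val (perm_of_points d pts i)) | i : 'I_d].
  rewrite map_inj_uniq ?enum_uniq // => i j [e _]; exact: val_inj.
apply: uniq_perm => //; first exact: map_uniq u1.
have ss : {subset [seq (val i, val (perm_of_points d pts i)) | i : 'I_d] <= pts}.
  by move=> _ /mapP[i _ ->].
have le2 : size pts <= size [seq (val i, val (perm_of_points d pts i)) | i : 'I_d].
  have := uniq_leq_size u1 sub1.
  by rewrite size_iota !size_map -enumT size_enum_ord.
by have [] := uniq_min_size us ss le2.
Qed.

Lemma size_filter_notin (s t : seq nat) : uniq s -> uniq t -> {subset s <= t} ->
  size [seq x <- t | x \notin s] = size t - size s.
Proof.
move=> us ut st.
have -> : size s = count (mem s) t.
  rewrite -size_filter; apply: perm_size; apply: uniq_perm => //.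
    exact: filter_uniq.
  by move=> x; rewrite mem_filter andb_idr //; exact: st.
by rewrite -(count_predC (mem s) t) addKn size_filter.
Qed.

Lemma unzip1_zip_take (T U : Type) (s : seq T) (t : seq U) :
  unzip1 (zip s t) = take (size t) s.
Proof. by elim: s t => [|x s IH] [|y t] //=; rewrite IH. Qed.

Lemma unzip2_zip_take (T U : Type) (s : seq T) (t : seq U) :
  unzip2 (zip s t) = take (size s) t.
Proof. by elim: s t => [|x s IH] [|y t] //=; rewrite IH. Qed.

Lemma embeddingP (a b : nat) (rho : 'M[bool]_(a, b)) : partial_perm rho ->
  perm_eq [seq (val i, val (embedding rho i)) | i : 'I_(a + b)]
          (embedding_points rho).
Proof.
case/andP => /forallP rowP /forallP colP.
have mpP p : p \in mx_points rho ->
    exists i j, [/\ rho i j, p.1 = val i :> nat & p.2 = val j :> nat].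
  by case/mapP => -[i j]; rewrite mem_filter => /andP[h _] ->; exists i, j.
have mp_uniq : uniq [seq p <- enum {: 'I_a * 'I_b} | rho p.1 p.2].
  by rewrite filter_uniq // enum_uniq.
have u1 : uniq (unzip1 (mx_points rho)).
  rewrite /unzip1 /mx_points -map_comp map_inj_in_uniq // => -[i j] [i' j'].
  rewrite !mem_filter /= => /andP[h _] /andP[h' _] /val_inj e; subst i'.
  have := rowP i; rewrite leqNgt; case: (eqVneq j j') => [->//|ne] /negP[].
  have <- : #|[set j; j']| = 2 by rewrite cards2 ne.
  by apply: subset_leq_card; apply/subsetP => x; rewrite !inE => /orP[]/eqP->.
have u2 : uniq (unzip2 (mx_points rho)).
  rewrite /unzip2 /mx_points -map_comp map_inj_in_uniq // => -[i j] [i' j'].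
  rewrite !mem_filter /= => /andP[h _] /andP[h' _] /val_inj e; subst j'.
  have := colP j; rewrite leqNgt; case: (eqVneq i i') => [->//|ne] /negP[].
  have <- : #|[set i; i']| = 2 by rewrite cards2 ne.
  by apply: subset_leq_card; apply/subsetP => x; rewrite !inE => /orP[]/eqP->.
set mp := mx_points rho in mpP u1 u2.
pose fr := free_rows mp (iota 0 a); pose top := mp ++ zip fr (iota b a).
have sub1 : {subset unzip1 mp <= iota 0 a}.
  by move=> _ /mapP[p /mpP[i [j [_ e _]]] ->]; rewrite e mem_iota /=.
have sub2 : {subset unzip2 mp <= iota 0 b}.
  by move=> _ /mapP[p /mpP[i [j [_ _ e]]] ->]; rewrite e mem_iota /=.
have szfr : size fr = a - size mp.
  by rewrite size_filter_notin ?iota_uniq // size_iota size_map.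
have lemp : size mp <= a.
  by have := uniq_leq_size u1 sub1; rewrite size_map size_iota.
have e1 : unzip1 top = unzip1 mp ++ fr.
  by rewrite /top /unzip1 map_cat -!/(unzip1 _) unzip1_zip_take take_oversize // size_iota szfr leq_subr.
have e2 : unzip2 top = unzip2 mp ++ iota b (a - size mp).
  rewrite /top /unzip2 map_cat -!/(unzip2 _) unzip2_zip_take szfr take_iota.
  by congr (_ ++ iota _ _); apply/minn_idPl; exact: leq_subr.
have ut1 : uniq (unzip1 top).
  rewrite e1 cat_uniq u1 filter_uniq ?iota_uniq // andbT.
  by apply/hasPn => x; rewrite mem_filter => /andP[].
have ut2 : uniq (unzip2 top).
  rewrite e2 cat_uniq u2 iota_uniq andbT; apply/hasPn => x; rewrite mem_iota => h.
  by apply/negP => /sub2; rewrite mem_iota; lia.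
have p1 : perm_eq (unzip1 top) (iota 0 a).
  apply: uniq_perm; rewrite ?iota_uniq // => x; rewrite e1 mem_cat mem_filter.
  by case: (boolP (x \in unzip1 mp)) => //= /sub1 ->.
have sub3 : {subset unzip2 top <= iota 0 (a + b)}.
  move=> x; rewrite e2 mem_cat => /orP[/sub2|]; rewrite !mem_iota; lia.
have sztop : size top = a.
  by rewrite -(size_map fst) (perm_size p1) size_iota.
pose fc := free_cols top (iota 0 (a + b)).
have szfc : size fc = b.
  rewrite size_filter_notin ?iota_uniq // size_iota size_map sztop; lia.
have E : embedding_points rho = top ++ zip (iota a b) fc by [].
have E1 : unzip1 (embedding_points rho) = unzip1 top ++ iota a b.
  by rewrite E /unzip1 map_cat -!/(unzip1 _) unzip1_zip_take szfc take_oversize ?size_iota.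
have E2 : unzip2 (embedding_points rho) = unzip2 top ++ fc.
  by rewrite E /unzip2 map_cat -!/(unzip2 _) unzip2_zip_take size_iota take_oversize ?szfc.
have s1 : {subset unzip1 (embedding_points rho) <= iota 0 (a + b)}.
  by move=> x; rewrite E1 mem_cat (perm_mem p1) !mem_iota; lia.
have s2 : {subset unzip2 (embedding_points rho) <= iota 0 (a + b)}.
  by move=> x; rewrite E2 mem_cat mem_filter => /orP[/sub3|/andP[]].
apply: perm_of_pointsP.
- rewrite E1 cat_uniq ut1 iota_uniq andbT; apply/hasPn => x.
  by rewrite (perm_mem p1) !mem_iota; lia.
- rewrite E2 cat_uniq ut2 filter_uniq ?iota_uniq // andbT.
  by apply/hasPn => x; rewrite mem_filter => /andP[].
- move=> p pP; have := s1 _ (map_f fst pP); have := s2 _ (map_f snd pP).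
  by rewrite !mem_iota /= => -> ->.
- by rewrite -(size_map fst) -/(unzip1 _) E1 size_cat size_map sztop size_iota.
Qed.

Lemma Posz_sum (I : Type) (s : seq I) (P : pred I) (F : I -> nat) :
  Posz (\sum_(i <- s | P i) F i) = (\sum_(i <- s | P i) Posz (F i))%R.
Proof. exact: (big_morph Posz PoszD (erefl (Posz 0))). Qed.

Lemma sum_row_points n r i : occur n r -> i <= n ->
  \sum_(j < n.+1) block_points n r i j + (if i < n then r i i.+1 else 0) = r i i.
Proof.
move=> [_ occ] le_in.
have tel K : (\sum_(0 <= k < K.+1) lace_array n r k i =
    rank n r K i - rank n r K (i%:Z + 1))%R.
  elim: K => [|K IH].
    by rewrite big_nat1 /lace_array /= subr0 addr0.
  rewrite big_nat_recr // IH /lace_array.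
  have -> : (K.+1%:Z - 1 = K%:Z)%R by lia.
  move: (rank n r K) (rank n r K.+1) => f g /=; lia.
have E : Posz (\sum_(j < n.+1) block_points n r i j) =
    (\sum_(0 <= k < i.+1) lace_array n r k i)%R.
  rewrite (reindex_inj rev_ord_inj) /= Posz_sum.
  rewrite -(big_mkord xpredT (fun j => Posz (block_points n r i (n.+1 - j.+1)))).
  rewrite (big_cat_nat (n := i.+1)) //=.
  rewrite [X in (_ + X)%R](_ : _ = 0%R) ?addr0; last first.
    rewrite big_nat_cond big1 // => k; rewrite andbT => hk.
    by rewrite /block_points subSS subKn ?ifF //; lia.
  apply: eq_big_nat => k hk; rewrite /block_points subSS subKn; last lia.
  rewrite ifT; last lia.
  by rewrite gez0_abs //; apply: occ; lia.
have := tel i; rewrite -E.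
have -> : rank n r i i = r i i by rewrite /rank le_in.
have -> : rank n r i (i%:Z + 1) = (if i < n then r i i.+1 else 0).
  by rewrite /rank /= le_in addn1; case: ltnP.
lia.
Qed.

Lemma sum_col_points n r j : occur n r -> j <= n ->
  \sum_(i < n.+1) block_points n r i j
    + (if j < n then r (n - j).-1 (n - j) else 0) = r (n - j) (n - j).
Proof.
move=> [_ occ] le_jn; set k := n - j.
have tel : (\sum_(k <= i < n.+1) lace_array n r k i =
    rank n r k k - rank n r (k%:Z - 1) k)%R.
  have -> : (\sum_(k <= i < n.+1) lace_array n r k i = (\sum_(k <= i < n.+1)
     ((rank n r (k%:Z - 1) i.+1 - rank n r k i.+1)
      - (rank n r (k%:Z - 1) i - rank n r k i)))%R)%R.
    apply: eq_bigr => i _; rewrite /lace_array.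
    have -> : (i%:Z + 1 = i.+1%:Z)%R by lia.
    lia.
  rewrite telescope_sumr; last lia.
  have z x : rank n r x n.+1 = 0%R by case: x => // x; rewrite /rank ltnn andbF.
  by rewrite !z; lia.
have E : Posz (\sum_(i < n.+1) block_points n r i j) =
    (\sum_(k <= i < n.+1) lace_array n r k i)%R.
  rewrite Posz_sum -(big_mkord xpredT (fun i => Posz (block_points n r i j))).
  rewrite (big_cat_nat (n := k)) //=; last lia.
  rewrite [X in (X + _)%R](_ : _ = 0%R) ?add0r; last first.
    rewrite big_nat_cond big1 // => i; rewrite andbT => hi.
    by rewrite /block_points -/k ifF //; lia.
  apply: eq_big_nat => i hi; rewrite /block_points -/k ifT; last lia.
  by rewrite gez0_abs //; apply: occ; lia.
have := tel; rewrite -E.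
have -> : rank n r k k = r k k by rewrite /rank leq_subr.
case: (ltnP j n) => h.
  have -> : (k%:Z - 1)%R = Posz k.-1 by lia.
  have -> : rank n r k.-1 k = r k.-1 k by rewrite /rank ifT //; lia.
  lia.
have -> : k = 0 by lia.
rewrite /=; lia.
Qed.

Local Notation offset h i := (\sum_(k < i) h k).

Lemma base_mono (h : nat -> nat) i i' : i < i' -> offset h i + h i <= offset h i'.
Proof.
move=> lt; have -> : offset h i + h i = \sum_(k < i.+1) h k by rewrite big_ord_recr.
rewrite -!(big_mkord xpredT h) [X in _ <= X](big_cat_nat (n := i.+1)) //=.
exact: leq_addr.
Qed.

Lemma base_inj (h : nat -> nat) i i' t t' : t < h i -> t' < h i' -> 
  offset h i + t = offset h i' + t' ->
  i = i' /\ t = t'.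
Proof.
move=> ht ht' e; case: (ltngtP i i') => [/(@base_mono h)|/(@base_mono h)|ei]; [lia|lia|].
by subst i'; split=> //; lia.
Qed.

(* In each interval [offset i, offset i + h i) exactly the last A i elements
   occur in occ. *)
Definition occupied (N : nat) (h : nat -> nat) (occ : seq nat)
    (A : nat -> nat) : Prop :=
  [/\ uniq occ,
      forall i t, i < N -> t < h i -> (offset h i + t \in occ) = (h i - A i <= t) &
      forall x, x \in occ -> x < offset h N].

Lemma occupied_step N (h : nat -> nat) occ A i m
    (new := take m (rev [seq x <- iota (offset h i) (h i) | x \notin occ])) :
  occupied N h occ A -> i < N -> A i + m <= h i ->
  size new = m /\ occupied N h (occ ++ new) (fun i' => A i' + (i' == i) * m).
Proof.
move=> [u mem bd] iN le.
have F : [seq x <- iota (offset h i) (h i) | x \notin occ] = iota (offset h i) (h i - A i).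
  rewrite -[h i in LHS](@subnK (A i)) ?iotaD ?filter_cat; last lia.
  have -> : [seq x <- iota (offset h i + (h i - A i)) (A i) | x \notin occ] = [::].
    apply/eqP; rewrite -size_eq0 size_filter -leqn0 leqNgt -has_count.
    apply/hasPn => x; rewrite mem_iota => hx; rewrite negbK.
    have -> : x = offset h i + (x - offset h i) by lia.
    by rewrite mem //; lia.
  rewrite cats0; apply/all_filterP/allP => x; rewrite mem_iota => hx.
  have -> : x = offset h i + (x - offset h i) by lia.
  by rewrite mem //; lia.
have mem_new x : (x \in new) = (offset h i + (h i - A i - m) <= x < offset h i + (h i - A i)).
  by rewrite /new F take_rev mem_rev drop_iota mem_iota size_iota; lia.
have sz : size new = m by rewrite /new size_take size_rev F size_iota; case: ifP; lia.
split=> //; split.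
- rewrite cat_uniq u /new F take_uniq ?rev_uniq ?iota_uniq // andbT.
  rewrite -F -/new; apply/hasPn => x /=; rewrite mem_new => hx.
  have -> : x = offset h i + (x - offset h i) by lia.
  by rewrite mem //; lia.
- move=> i' t i'N ht; rewrite mem_cat mem // mem_new.
  case: (eqVneq i' i) => [->|ne]; first by rewrite mul1n; lia.
  rewrite mul0n addn0; case: (ltngtP i' i) => [/(@base_mono h)|/(@base_mono h)|e]; try by move=> ?; lia.
  by move: ne; rewrite e eqxx.
- move=> x; rewrite mem_cat => /orP[/bd//|]; rewrite mem_new.
  by have := @base_mono h _ _ iN; lia.
Qed.


Definition row_load n r (P : seq (nat * nat)) (i : nat) : nat :=
  \sum_(j < n.+1 | (i, val j) \in P) block_points n r i j.
Definition col_load n r (P : seq (nat * nat)) (j : nat) : nat :=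
  \sum_(i < n.+1 | (val i, j) \in P) block_points n r i j.

Lemma load_rcons n (a : nat) (F : nat -> nat) (Q Q' : pred nat) :
    a <= n -> ~~ Q a -> (forall x, Q' x = Q x || (x == a)) ->
  \sum_(j < n.+1 | Q' j) F j = \sum_(j < n.+1 | Q j) F j + F a.
Proof.
move=> an na e; pose a' : 'I_n.+1 := Ordinal (an : a < n.+1).
rewrite (bigD1 a') /=; last by rewrite e eqxx orbT.
rewrite addnC; congr (_ + _); apply: eq_bigl => j; rewrite e.
case: (eqVneq j a') => [->|ne]; first by rewrite andbF (negPf na).
rewrite andbT; suff -> : (j == a :> nat) = false by rewrite orbF.
by apply/negP => /eqP ej; case/negP: ne; apply/eqP/val_inj.
Qed.

Lemma southeast_points_inv n r P (pts := foldl (fill_block n r) [::] P) :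
    occur n r -> uniq P -> {in P, forall p, (p.1 <= n) && (p.2 <= n)} ->
  [/\ occupied n.+1 (fun i => r i i) (unzip1 pts) (row_load n r P),
      occupied n.+1 (fun j => r (n - j) (n - j)) (unzip2 pts) (col_load n r P) &
      size pts = \sum_(i < n.+1) row_load n r P i].
Proof.
move=> occ; rewrite {}/pts; elim/last_ind: P => [|P [i j] IH].
  move=> _ _ /=; split=> //.
  - by split=> // i t _ ht; rewrite in_nil /row_load big_pred0 // subn0 leqNgt ht.
  - by split=> // i t _ ht; rewrite in_nil /col_load big_pred0 // subn0 leqNgt ht.
  - by rewrite big1 // => i _; rewrite /row_load big_pred0.
rewrite rcons_uniq => /andP[nP uP] bd.
have /andP[/= i_n j_n] : ((i, j).1 <= n) && ((i, j).2 <= n).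
  by apply: bd; rewrite mem_rcons inE eqxx.
have bdP : {in P, forall p, (p.1 <= n) && (p.2 <= n)}.
  by move=> p hp; apply: bd; rewrite mem_rcons inE hp orbT.
have [R C S] := IH uP bdP.
rewrite foldl_rcons; set pts := foldl _ _ _ in R C S *.
set m := block_points n r i j.
have rowE i' : row_load n r (rcons P (i, j)) i' = row_load n r P i' + (i' == i) * m.
  rewrite /row_load; case: (eqVneq i' i) => [->|ne].
    rewrite mul1n; apply: (@load_rcons n j (block_points n r i)
      (fun x => (i, x) \in P) (fun x => (i, x) \in rcons P (i, j))) => //.
    by move=> x; rewrite mem_rcons inE xpair_eqE eqxx orbC.
  rewrite mul0n addn0; apply: eq_bigl => x.
  by rewrite mem_rcons inE xpair_eqE (negPf ne).
have colE j' : col_load n r (rcons P (i, j)) j' = col_load n r P j' + (j' == j) * m.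
  rewrite /col_load; case: (eqVneq j' j) => [->|ne].
    rewrite mul1n; apply: (@load_rcons n i (fun x => block_points n r x j)
      (fun x => (x, j) \in P) (fun x => (x, j) \in rcons P (i, j))) => //.
    by move=> x; rewrite mem_rcons inE xpair_eqE eqxx andbT orbC.
  rewrite mul0n addn0; apply: eq_bigl => x.
  by rewrite mem_rcons inE xpair_eqE (negPf ne) andbF.
have leR : row_load n r P i + m <= r i i.
  have := rowE i; rewrite eqxx mul1n => <-.
  rewrite -(sum_row_points occ i_n); apply: leq_trans (leq_addr _ _).
  by rewrite /row_load big_mkcond leq_sum // => k _; case: ifP.
have leC : col_load n r P j + m <= r (n - j) (n - j).
  have := colE j; rewrite eqxx mul1n => <-.
  rewrite -(sum_col_points occ j_n); apply: leq_trans (leq_addr _ _).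
  by rewrite /col_load big_mkcond leq_sum // => k _; case: ifP.
have [sR R'] := occupied_step R (i_n : i < n.+1) leR.
have [sC C'] := occupied_step C (j_n : j < n.+1) leC.
rewrite /fill_block -/m /free_rows /free_cols.
set nr := take m _ in sR R'; set nc := take m _ in sC C'.
rewrite /unzip1 /unzip2 !map_cat -!/(unzip1 _) -!/(unzip2 _).
rewrite unzip1_zip_take unzip2_zip_take.
rewrite -[take m (rev [seq _ <- iota (block_row r i) _ | _])]/nr.
rewrite -[take m (rev [seq _ <- iota (block_col n r j) _ | _])]/nc.
rewrite !take_oversize ?sR ?sC //; split.
- by case: R' => u e b; split=> // i' t h1 h2; rewrite e // rowE.
- by case: C' => u e b; split=> // i' t h1 h2; rewrite e // colE.
- rewrite size_cat S size1_zip ?sR ?sC //.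
  rewrite (eq_bigr _ (fun k _ => rowE (val k))) big_split /=; congr (_ + _).
  rewrite (bigD1 (Ordinal (i_n : i < n.+1))) //= eqxx mul1n big1 ?addn0 // => k.
  by rewrite -val_eqE /= => /negPf ->.
Qed.

Lemma zelevinskyP n r : occur n r ->
  perm_eq [seq (val i, val (zelevinsky n r i)) | i : 'I_(total_dim n r)]
          (zelevinsky_points n r).
Proof.
move=> occ; set d := total_dim n r.
pose P := [seq (i, j) | i <- rev (iota 0 n.+1), j <- rev (iota 0 n.+1)].
have memP i j : ((i, j) \in P) = (i <= n) && (j <= n).
  apply/allpairsP/idP => [[[a b] [ha hb [-> ->]]]|h].
    by move: ha hb; rewrite !mem_rev !mem_iota /=; lia.
  by exists (i, j); rewrite !mem_rev !mem_iota; split=> //=; lia.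
have uP : uniq P.
  by apply: allpairs_uniq; rewrite ?rev_uniq ?iota_uniq // => -[? ?] [? ?] _ _ [-> ->].
have bdP : {in P, forall p, (p.1 <= n) && (p.2 <= n)}.
  by move=> [i j]; rewrite memP.
have [] := southeast_points_inv occ uP bdP.
rewrite -[foldl _ _ _]/(southeast_points n r); set pts := southeast_points n r.
pose q i := if i < n then r i i.+1 else 0.
have rowE i : i <= n -> row_load n r P i + q i = r i i.
  move=> hi; rewrite -[RHS](sum_row_points occ hi); congr (_ + _).
  by apply: eq_bigl => j; rewrite memP hi -ltnS ltn_ord.
have colE i : i < n -> col_load n r P (n - i.+1) + q i = r i.+1 i.+1.
  move=> hi; have hj : n - i.+1 <= n by lia.
  have := sum_col_points occ hj.
  rewrite subKn // (_ : n - i.+1 < n) /=; last lia.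
  move=> <-; rewrite /q hi; congr (_ + _).
  by apply: eq_bigl => j; rewrite memP hj -ltnS ltn_ord.
move=> [u1 m1 b1] [u2 m2 b2] S.
have diagE i : i < n -> diagonal_points n r pts i =
    [seq (block_row r i + t, block_col n r (n - i.+1) + t) | t <- iota 0 (q i)].
  move=> hi; have ER := rowE i (ltnW hi); have EC := colE i hi.
  have lq : q i <= minn (r i i) (r i.+1 i.+1) by rewrite leq_min; lia.
  rewrite /diagonal_points filter_map; congr map.
  have test t : t < minn (r i i) (r i.+1 i.+1) ->
      (block_row r i + t \notin unzip1 pts) &&
      (block_col n r (n - i.+1) + t \notin unzip2 pts) = (t < q i).
    rewrite leq_min => /andP[t1 t2]; rewrite m1 ?m2 ?subKn //; lia.
  rewrite -[minn _ _](subnKC lq) iotaD filter_cat.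
  rewrite [X in _ ++ X](_ : _ = [::]) ?cats0.
    by apply/all_filterP/allP => t; rewrite mem_iota => ht /=; rewrite test; lia.
  apply/eqP; rewrite -size_eq0 size_filter -leqn0 leqNgt -has_count.
  by apply/hasPn => t; rewrite mem_iota => ht /=; rewrite test; lia.
pose diag := [seq (block_row r i + t, block_col n r (n - i.+1) + t)
             | i <- iota 0 n, t <- iota 0 (q i)].
have E : zelevinsky_points n r = pts ++ diag.
  rewrite /zelevinsky_points -/pts; congr (_ ++ flatten _).
  by apply/eq_in_map => i; rewrite mem_iota => /diagE.
have q1 i : i < n -> q i <= r i i by move=> /ltnW/rowE; lia.
have q2 i : i < n -> q i <= r i.+1 i.+1 by move=> /colE; lia.
have memd p : p \in diag -> exists i t, [/\ i < n, t < q i,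
    p.1 = block_row r i + t & p.2 = block_col n r (n - i.+1) + t].
  case/allpairsPdep => i [t [hi ht ->]]; exists i, t.
  by move: hi ht; rewrite !mem_iota.
have ed1 : unzip1 diag = [seq block_row r i + t | i <- iota 0 n, t <- iota 0 (q i)].
  by rewrite /unzip1 map_allpairs.
have ed2 : unzip2 diag =
    [seq block_col n r (n - i.+1) + t | i <- iota 0 n, t <- iota 0 (q i)].
  by rewrite /unzip2 map_allpairs.
have ud1 : uniq (unzip1 diag).
  rewrite ed1; apply: allpairs_uniq_dep; first exact: iota_uniq.
    by move=> i _; exact: iota_uniq.
  move=> _ _ /allpairsPdep[i [t [hi ht ->]]] /allpairsPdep[i' [t' [hi' ht' ->]]] /= e.
  move: hi ht hi' ht'; rewrite !mem_iota /= => hi ht hi' ht'.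
  have [||<- <-] := @base_inj (fun i => r i i) _ _ _ _ _ _ e; last by [].
    exact: leq_trans ht (q1 _ _).
  exact: leq_trans ht' (q1 _ _).
have ud2 : uniq (unzip2 diag).
  rewrite ed2; apply: allpairs_uniq_dep; first exact: iota_uniq.
    by move=> i _; exact: iota_uniq.
  move=> _ _ /allpairsPdep[i [t [hi ht ->]]] /allpairsPdep[i' [t' [hi' ht' ->]]] /= e.
  move: hi ht hi' ht'; rewrite !mem_iota /= => hi ht hi' ht'.
  have [|| ei et] := @base_inj (fun j => r (n - j) (n - j)) _ _ _ _ _ _ e.
  - by rewrite subKn //; exact: leq_trans ht (q2 _ _).
  - by rewrite subKn //; exact: leq_trans ht' (q2 _ _).
  have -> : i = i' by lia.
  by rewrite et.
have dC : d = \sum_(k < n.+1) r (n - k) (n - k).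
  by rewrite /d /total_dim (reindex_inj rev_ord_inj).
have bd : {in zelevinsky_points n r, forall p, (p.1 < d) && (p.2 < d)}.
  move=> p; rewrite E mem_cat => /orP[hp|/memd[i [t [hi ht -> ->]]]].
    by rewrite b1 ?map_f //= dC b2 ?map_f.
  have := q1 _ hi; have := q2 _ hi => h2 h1.
  have hi' : i < n.+1 by lia.
  have hj' : n - i.+1 < n.+1 by lia.
  have /= := @base_mono (fun i => r i i) _ _ hi'.
  have /= := @base_mono (fun j => r (n - j) (n - j)) _ _ hj'.
  rewrite -dC -[\sum_(k < n.+1) r k k]/d -/(block_row r i).
  rewrite -/(block_col n r (n - i.+1)) subKn //; lia.
apply: perm_of_pointsP => //.
- rewrite E /unzip1 map_cat -!/(unzip1 _) cat_uniq u1 ud1 andbT.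
  apply/hasPn => _ /mapP[p /memd[i [t [hi ht -> _]]] ->] /=.
  have tr : t < r i i := leq_trans ht (q1 _ hi).
  have := rowE _ (ltnW hi); rewrite (m1 i t) ?(leqW hi) //=; lia.
- rewrite E /unzip2 map_cat -!/(unzip2 _) cat_uniq u2 ud2 andbT.
  apply/hasPn => _ /mapP[p /memd[i [t [hi ht _ ->]]] ->] /=.
  have tr : t < r (n - (n - i.+1)) (n - (n - i.+1)).
    by rewrite subKn //; exact: leq_trans ht (q2 _ hi).
  have hj : n - i.+1 < n.+1 by lia.
  have := colE _ hi; rewrite (m2 _ t hj tr) /= subKn //; lia.
- rewrite E size_cat S size_allpairs_dep sumnE big_map.
  rewrite (eq_bigr q) => [|i _]; last by rewrite size_iota.
  have -> : \sum_(i <- iota 0 n) q i = \sum_(i < n.+1) q i.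
    by rewrite big_ord_recr /= /q ltnn addn0 -/(index_iota 0 n) -[n in iota 0 n]subn0 big_mkord.
  by rewrite -big_split /=; apply: leq_sum => i _; rewrite rowE // -ltnS.
Qed.

(* Main.v *)
(* Let D be the tiling with crosses in all blocks above the superantidiagonal,
   elbows on and below the antidiagonal, and in M_(i, n-i-1) the bottom pipe
   dream of w_(i+1) turned upside down. A pipe that passes through the top of
   the antidiagonal block of row i then follows a lace of W to its left end k
   and leaves through block column n-k, so D maps to W and its exit permutation
   u has one point in M_(i, n-k) for each (k, i)-lace. Hence u has the same
   block counts as v(r). Pairs of points in blocks that are strictly inverted
   are inversions of u, and a telescoping computation shows that their number
   is l(W) plus the area above the superantidiagonal when l(W) = d(r), i.e. the
   number of crosses of D. Since every inversion of u uses up a cross, all these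
   numbers agree: D is reduced, and u has no inversion inside a block row or a
   block column, which forces u = v(r). *)

Require Import Defs.
From mathcomp Require Import all_boot all_order all_algebra all_fingroup.
From mathcomp Require Import zify.

Set Implicit Arguments.
Unset Strict Implicit.
Unset Printing Implicit Defensive.

Import GRing.Theory.

(** * Pipes as maps on columns *)

(** Exact exit columns are never computed and pairs of pipes are never followed through several
    blocks; the only pairwise fact is that two pipes which change their order meet in a cross. For
    every lacing diagram of [r] the block inversions number [expected_codim n r] plus the area above
    the superantidiagonal, while the crosses number the length of [W] plus the same area. Minimal
    length is thus what makes the two counts equal.

    The laces alone give only an upper bound for the blocks on and below the antidiagonal, since it
    is not shown directly that every right end of a lace is met by a pipe from the left side. The
    known row and column sums supply the missing half.

    The crossed boxes of a superantidiagonal block are chosen so that in row [s] from the bottom,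
    the pipe in the last elbow before them is the one of the vertex joined to [s]. It is carried
    over the crosses and out of the right side of the block, while the other pipes stay in order
    inside. The Lehmer code is the number of pipes to the right that must be passed, which is why
    the crosses add up to the length. *)

Section RowMap.

Variables (d : nat) (C : nat -> nat -> bool).
Hypothesis C_tri : forall p q, C p q -> p + q + 2 <= d.

(** A window of [d + 1] columns suffices: by [C_tri] its last column [x + d] holds no cross. *)
Definition next_elbow (p x : nat) : nat :=
  x + find (fun y => ~~ C p y) (iota x d.+1).

Definition row_map (p q : nat) : nat := if C p q then q else next_elbow p q.+1.

(* [rise m p q] is the column in which a pipe crossing the line below row
   p + m - 1 in column q crosses the line above row p. *)
Fixpoint rise (m p q : nat) : nat :=
  if m is m'.+1 then row_map p (rise m' p.+1 q) else q.

Lemma next_elbowP p x : [/\ x <= next_elbow p x, ~~ C p (next_elbow p x) &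
  forall y, x <= y < next_elbow p x -> C p y].
Proof.
have h : has (fun y => ~~ C p y) (iota x d.+1).
  apply/hasP; exists (x + d); first by rewrite mem_iota; lia.
  by apply/negP => /C_tri; lia.
have lt := h; rewrite has_find size_iota in lt.
split; first exact: leq_addr.
  by have := nth_find 0 h; rewrite nth_iota.
move=> y /andP[xy]; rewrite -ltn_subLR // => yf.
have := before_find 0 yf; rewrite nth_iota ?subnKC //; last by apply: ltn_trans yf lt.
by move/negbFE.
Qed.

Lemma next_elbow_eq p x y : x <= y -> ~~ C p y -> (forall z, x <= z < y -> C p z) ->
  next_elbow p x = y.
Proof.
move=> xy ny cy; have [h1 h2 h3] := next_elbowP p x.
case: (ltngtP (next_elbow p x) y) => // h.
  by rewrite cy ?h1 in h2.
by rewrite h3 ?xy in ny.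
Qed.

Lemma next_elbow_bound p x : p + x < d -> p + next_elbow p x < d.
Proof.
move=> h; have [h1 h2 h3] := next_elbowP p x.
case: (ltnP (p + next_elbow p x) d) => // le.
have /C_tri : C p (d - p.+1) by apply: h3; lia.
lia.
Qed.

Lemma row_map_bound p q : p.+1 + q < d -> p + row_map p q < d.
Proof.
rewrite /row_map; case: ifP => _ h; first lia.
by apply: next_elbow_bound; lia.
Qed.

Lemma rise_bound m p q : p + m + q < d -> p + rise m p q < d.
Proof.
elim: m p q => [|m IH] p q /= h; first lia.
by apply: row_map_bound; apply: IH; lia.
Qed.

Lemma riseD m k p q : rise (m + k) p q = rise m p (rise k (p + m) q).
Proof.
elim: m p => [|m IH] p /=; first by rewrite addn0.
by rewrite IH addSnnS.
Qed.

(** Two pipes can exchange their order in a row only if the left one runs horizontally through the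
    cross in which the right one goes up; the second alternative exhibits that box [(p, q')]. *)
Lemma row_map_lt p q q' : q < q' -> row_map p q < row_map p q' \/
  [/\ C p q', ~~ C p q & q' < row_map p q].
Proof.
move=> lt; rewrite /row_map.
have [a1 a2 a3] := next_elbowP p q.+1; have [b1 _ _] := next_elbowP p q'.+1.
case: (boolP (C p q)) => Cq; case: (boolP (C p q')) => Cq'; try by left; lia.
  case: (ltngtP (next_elbow p q.+1) q') => h; [by left|by right|].
  by rewrite h Cq' in a2.
left; case: (ltnP q' (next_elbow p q.+1)) => h; last lia.
by rewrite a3 ?lt in Cq'.
Qed.

(** A pipe entering at the left side behaves like one to the left of every column. *)
Lemma next_elbow_lt p q : next_elbow p 0 < row_map p q \/ C p q /\ q < next_elbow p 0.
Proof.
rewrite /row_map.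
have [a1 a2 a3] := next_elbowP p 0; have [b1 _ _] := next_elbowP p q.+1.
case: (boolP (C p q)) => Cq.
  by case: (ltngtP (next_elbow p 0) q) => h; [left|right|rewrite h Cq in a2].
left; case: (ltnP q (next_elbow p 0)) => h; last lia.
by rewrite a3 in Cq.
Qed.

Lemma row_map_inj p : injective (row_map p).
Proof.
suff L q q' : q < q' -> row_map p q != row_map p q'.
  move=> q q' /eqP e; case: (ltngtP q q') => // /L; first by rewrite e.
  by rewrite eq_sym e.
case/(@row_map_lt p) => [|[Cq' _]]; first by rewrite neq_ltn => ->.
by rewrite {1}[row_map p q']/row_map Cq' neq_ltn orbC => ->.
Qed.

Lemma rise_inj m p : injective (rise m p).
Proof. by elim: m p => [|m IH] p q q' //= /row_map_inj /IH. Qed.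

Lemma next_elbow_row_map_neq p q : next_elbow p 0 != row_map p q.
Proof.
case: (next_elbow_lt p q) => [|[Cq]]; first by rewrite neq_ltn => ->.
by rewrite /row_map Cq neq_ltn orbC => ->.
Qed.

(** Where the pipe entering at the left of row [p + m] crosses the line above row [p]; for [p = 0]
    this is its exit column. *)
Definition column_at (p m : nat) : nat := rise m p (next_elbow (p + m) 0).

Lemma column_at_bound p m : p + m < d -> p + column_at p m < d.
Proof.
by move=> h; apply: rise_bound; apply: next_elbow_bound; rewrite addn0.
Qed.

Lemma column_atD p m k : column_at p (m + k) = rise m p (column_at (p + m) k).
Proof. by rewrite /column_at riseD addnA. Qed.

Lemma column_atS p m : column_at p m.+1 = row_map p (column_at p.+1 m).
Proof. by rewrite /column_at /= addSnnS. Qed.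

(** * Pipes as paths in the grid *)

Definition grid_coord (e : grid_edge d) : bool * nat * nat :=
  match e with
  | inl pq => (true, val pq.1, val pq.2)
  | inr pq => (false, val pq.1, val pq.2)
  end.

Lemma grid_coord_inj : injective grid_coord.
Proof.
by move=> [[p q]|[p q]] [[p' q']|[p' q']] //= [/val_inj -> /val_inj ->].
Qed.

Definition pipes_of : pipe_dream d := (\matrix_(p, q) C p q)%R.

Lemma pipe_stepP e f : reflect
  (exists p q, [/\ p < d, q < d &
     grid_coord e = (false, p, q) /\
       grid_coord f = (if C p q then (false, p, q.+1) else (true, p, q)) \/
     grid_coord e = (true, p.+1, q) /\
       grid_coord f = (if C p q then (true, p, q) else (false, p, q.+1))])
  (pipe_step pipes_of e f).
Proof.
apply: (iffP existsP) => [[[p q]] /= |[p [q [hp hq h]]]].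
  rewrite mxE => h; exists p, q; split; rewrite ?ltn_ord //.
  by case/orP: h => /andP[/eqP -> /eqP ->]; [left|right]; split=> //; case: ifP.
exists (Ordinal hp, Ordinal hq); rewrite mxE /=; apply/orP.
case: h => -[h1 h2]; [left|right]; apply/andP; split; apply/eqP/grid_coord_inj.
all: rewrite ?h1 ?h2 /= /bump ?leq0n ?add1n //.
all: by case: ifP => //= _; rewrite /bump leq0n add1n.
Qed.

(** Connectivity is stated on coordinates so that path arguments need no ordinals. *)
Definition reach (x y : bool * nat * nat) : Prop := exists e f,
  [/\ grid_coord e = x, grid_coord f = y & connect (pipe_step pipes_of) e f].

Lemma reach_trans y x z : reach x y -> reach y z -> reach x z.
Proof.
move=> [e [f [ex fy ef]]] [f' [g [fy' gz fg]]]; exists e, g; split=> //.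
apply: connect_trans ef _; suff -> : f = f' by [].
by apply: grid_coord_inj; rewrite fy.
Qed.

Definition in_grid (x : bool * nat * nat) : bool :=
  let: (h, p, q) := x in if h then (p <= d) && (q < d) else (p < d) && (q <= d).

Lemma in_gridP x : reflect (exists e, grid_coord e = x) (in_grid x).
Proof.
case: x => [[[] p] q] /=; apply: (iffP andP) => [[hp hq]|[[[p' q']|[p' q']]] //= [<- <-]].
- by exists (inl (Ordinal (hp : p < d.+1), Ordinal hq)).
- by have := ltn_ord p'; have := ltn_ord q'; split; lia.
- by exists (inr (Ordinal hp, Ordinal (hq : q < d.+1))).
- by have := ltn_ord p'; have := ltn_ord q'; split; lia.
Qed.

Lemma reach_refl x : in_grid x -> reach x x.
Proof. by case/in_gridP => e ex; exists e, e; split=> //; exact: connect0. Qed.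

Lemma reach_step x y p q : p < d -> q < d ->
  x = (false, p, q) /\ y = (if C p q then (false, p, q.+1) else (true, p, q)) \/
  x = (true, p.+1, q) /\ y = (if C p q then (true, p, q) else (false, p, q.+1)) ->
  reach x y.
Proof.
move=> hp hq h.
have [e ex] : exists e, grid_coord e = x.
  by apply/in_gridP; case: h => -[-> _] /=; lia.
have [f fy] : exists f, grid_coord f = y.
  by apply/in_gridP; case: h => -[_ ->]; case: ifP => _ /=; lia.
exists e, f; split=> //; apply: connect1; apply/pipe_stepP; exists p, q; split=> //.
by rewrite ex fy.
Qed.

Lemma reach_crosses p x y : p < d -> x <= y <= d -> (forall z, x <= z < y -> C p z) ->
  reach (false, p, x) (false, p, y).
Proof.
move=> hp; elim: y => [|y IH] xy h.
  have -> : x = 0 by lia.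
  by apply: reach_refl; rewrite /= hp.
case: (ltngtP x y.+1) => [lt|lt|->]; [|lia|by apply: reach_refl => /=; lia].
have hy : y < d by lia.
apply: (@reach_trans (false, p, y)).
  by apply: IH; [lia|move=> z hz; apply: h; lia].
apply: (reach_step hp hy); left; split=> //.
by rewrite h //; lia.
Qed.

Lemma reach_next_elbow p x : p + x < d ->
  reach (false, p, x) (true, p, next_elbow p x).
Proof.
move=> h; have := next_elbow_bound h; have [h1 h2 h3] := next_elbowP p x => b.
have hp : p < d by lia.
have hq : next_elbow p x < d by lia.
apply: (@reach_trans (false, p, next_elbow p x)).
  by apply: reach_crosses => //; lia.
by apply: (reach_step hp hq); left; rewrite (negbTE h2).
Qed.

Lemma reach_row_map p q : p.+1 + q < d -> reach (true, p.+1, q) (true, p, row_map p q).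
Proof.
move=> h; have hp : p < d by lia.
have hq : q < d by lia.
rewrite /row_map; case: ifP => Cq.
  by apply: (reach_step hp hq); right; rewrite Cq.
apply: (@reach_trans (false, p, q.+1)).
  by apply: (reach_step hp hq); right; rewrite Cq.
by apply: reach_next_elbow; lia.
Qed.

Lemma reach_rise m p q : p + m + q < d -> reach (true, p + m, q) (true, p, rise m p q).
Proof.
elim: m p => [|m IH] p h /=.
  by rewrite addn0; apply: reach_refl => /=; lia.
apply: (@reach_trans (true, p.+1, rise m p.+1 q)).
  by rewrite addnS -addSn; apply: IH; lia.
by apply: reach_row_map; apply: rise_bound; lia.
Qed.

Lemma reach_column_at p m : p + m < d ->
  reach (false, p + m, 0) (true, p, column_at p m).
Proof.
move=> h; apply: (@reach_trans (true, p + m, next_elbow (p + m) 0)).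
  by apply: reach_next_elbow; rewrite addn0.
by apply: reach_rise; apply: next_elbow_bound; rewrite addn0.
Qed.

(** The pair is ordered: the pipe of row [p] is the horizontal one. This orientation lets the box
    determine the pair. *)
Definition crossing_pair (p p' : nat) : Prop := exists x y,
  [/\ x < d, y < d, C x y, reach (false, p, 0) (false, x, y) &
      reach (false, p', 0) (true, x.+1, y)].

(** The upper pipe joins to the left of the lower one or crosses it at once. Any later change of
    order happens in a definite row, and [row_map_lt] finds the cross there. *)
Lemma column_at_order p m m' : m < m' -> p + m' < d ->
  column_at p m != column_at p m' /\
  (column_at p m < column_at p m' \/ crossing_pair (p + m) (p + m')).
Proof.
elim: m p m' => [|m IH] p [|m'] // lt hd; rewrite ?column_atS.
  have B : p.+1 + column_at p.+1 m' < d by apply: column_at_bound; lia.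
  have R : reach (false, p + m'.+1, 0) (true, p.+1, column_at p.+1 m').
    by rewrite addnS -addSn; apply: reach_column_at; lia.
  set q := column_at p.+1 m' in B R *.
  rewrite /column_at /= addn0; split; first exact: next_elbow_row_map_neq.
  case: (next_elbow_lt p q) => [|[Cq lq]]; [by left|right].
  exists p, q; split=> //; try lia.
  apply: reach_crosses; try lia.
  by have [_ _ h3] := next_elbowP p 0 => z hz; apply: h3; lia.
have hd' : p.+1 + m' < d by lia.
have [ne or] := IH p.+1 m' lt hd'; split; first by rewrite (inj_eq (@row_map_inj p)).
case: or => [or|cr]; last by right; rewrite !addnS -!addSn.
have B : p.+1 + column_at p.+1 m < d by apply: column_at_bound; lia.
have B' : p.+1 + column_at p.+1 m' < d by apply: column_at_bound.
case: (row_map_lt p or) => [|[Cq nC lq]]; [by left|right].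
exists p, (column_at p.+1 m'); split=> //; try lia.
  apply: (@reach_trans (true, p.+1, column_at p.+1 m)).
    by rewrite addnS -addSn; apply: reach_column_at; lia.
  have hp : p < d by lia.
  have hq : column_at p.+1 m < d by lia.
  apply: (@reach_trans (false, p, (column_at p.+1 m).+1)).
    by apply: (reach_step hp hq); right; rewrite (negbTE nC).
  apply: reach_crosses; try lia.
  move: lq; rewrite /row_map (negbTE nC) => lq z hz.
  by have [_ _ h3] := next_elbowP p (column_at p.+1 m).+1; apply: h3; lia.
by rewrite addnS -addSn; apply: reach_column_at.
Qed.

Lemma column_at_inj p m m' : p + m < d -> p + m' < d ->
  column_at p m = column_at p m' -> m = m'.
Proof.
move=> h h' e; case: (ltngtP m m') => // lt.
  by case: (column_at_order lt h'); rewrite e eqxx.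
by case: (column_at_order lt h); rewrite e eqxx.
Qed.


Lemma pipe_step_inj e e' f : pipe_step pipes_of e f -> pipe_step pipes_of e' f -> e = e'.
Proof.
move=> /pipe_stepP[p [q [_ _ h]]] /pipe_stepP[p' [q' [_ _ h']]].
apply: grid_coord_inj; move: h h'.
by case=> [] [-> ->]; case=> [] [-> ]; case: ifP => c; case: ifP => c' [] *; subst;
  rewrite ?c in c' *.
Qed.

Lemma pipe_step_det e f g : pipe_step pipes_of e f -> pipe_step pipes_of e g -> f = g.
Proof.
move=> /pipe_stepP[p [q [_ _ h]]] /pipe_stepP[p' [q' [_ _ h']]].
apply: grid_coord_inj; move: h h'.
by case=> [] [-> ->]; case=> [] [[]] // -> -> ->.
Qed.

Definition entry (e : grid_edge d) : Prop :=
  (exists p, e = left_entry p) \/ (exists q, e = bottom_entry q).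

Lemma pipesP P : reflect (exists2 e, entry e & P = pipe pipes_of e) (P \in pipes pipes_of).
Proof.
apply: (iffP setUP) => [[/imsetP[p _ ->]|/imsetP[q _ ->]]|[e [[p ->]|[q ->]] ->]].
- by exists (left_entry p) => //; left; exists p.
- by exists (bottom_entry q) => //; right; exists q.
- by left; apply: imset_f.
- by right; apply: imset_f.
Qed.

Lemma entry_no_pred e f : entry f -> ~~ pipe_step pipes_of e f.
Proof.
move=> ent; apply/pipe_stepP => -[p [q [hp hq h]]].
have {h}: grid_coord f = (false, p, q.+1) \/ grid_coord f = (true, p, q).
  by case: h => -[_ ->]; case: ifP; auto.
by case: ent => -[x ->] /= [] // [] *; subst; lia.
Qed.

Lemma connect_entry e f : entry f -> connect (pipe_step pipes_of) e f -> e = f.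
Proof.
move=> ent /connectP[s]; elim/last_ind: s => [|s x _] //=.
rewrite rcons_path last_rcons => /andP[_ h] fx; subst x.
by case/negP: (entry_no_pred (last e s) ent).
Qed.

Lemma connect_entry_inj e e' f : entry e -> entry e' ->
  connect (pipe_step pipes_of) e f -> connect (pipe_step pipes_of) e' f -> e = e'.
Proof.
move=> ent ent' /connectP[s]; elim/last_ind: s f => [|s x IH] f /=.
  by move=> _ -> /connect_entry->.
rewrite rcons_path last_rcons => /andP[ps st] -> /connectP[s'].
case/lastP: s' => [|s' y] /=.
  by move=> _ xe'; rewrite xe' in st; case/negP: (entry_no_pred (last e s) ent').
rewrite rcons_path last_rcons => /andP[ps' st'] xy; subst y.
apply: (IH (last e s)) => //; apply/connectP; exists s' => //.
exact: pipe_step_inj st st'.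
Qed.

Lemma connect_total e f g : connect (pipe_step pipes_of) e f ->
  connect (pipe_step pipes_of) e g ->
  connect (pipe_step pipes_of) f g \/ connect (pipe_step pipes_of) g f.
Proof.
move=> /connectP[s]; elim: s e => [|x s IH] e /=; first by move=> _ ->; left.
case/andP=> st ps fx /connectP[[|y s'] /=].
  by move=> _ ->; right; apply/connectP; exists (x :: s); rewrite //= st.
case/andP=> st' ps' gy; rewrite (pipe_step_det st' st) in ps' gy.
by apply: (IH x ps fx); apply/connectP; exists s'.
Qed.

Lemma pipe_edgeP (f : grid_edge d) : exists2 P, P \in pipes pipes_of & f \in P.
Proof.
suff [e ent ef] : exists2 e, entry e & connect (pipe_step pipes_of) e f.
  by exists (pipe pipes_of e); [apply/pipesP; exists e|rewrite inE].
(* Each step backwards along a pipe lowers [mu] by exactly one, whether through a cross or an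
   elbow. *)
pose mu (x : bool * nat * nat) := d + x.2 + x.1.1 - x.1.2.
have [m] := ubnP (mu (grid_coord f)); elim: m f => // m IH f.
have base e : pipe_step pipes_of e f -> mu (grid_coord e) < mu (grid_coord f) ->
    mu (grid_coord f) < m.+1 -> exists2 e', entry e' & connect (pipe_step pipes_of) e' f.
  move=> st lt lt'; have [|e' ent h] := IH e; first lia.
  by exists e' => //; apply: connect_trans h (connect1 st).
case: f base => -[p q] base lt.
- have := ltn_ord p; have hq := ltn_ord q.
  rewrite ltnS leq_eqVlt => /orP[/eqP pd|hp].
    exists (bottom_entry q) => //; first by right; exists q.
    rewrite (_ : inl _ = bottom_entry q) ?connect0 //.
    by apply: grid_coord_inj; rewrite /= pd.
  case Cpq: (C p q).
    have [e he] : exists e, grid_coord e = (true, p.+1, val q).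
      by apply/in_gridP => /=; lia.
    apply: (base e) => //; last by rewrite he /mu /=; lia.
    apply/pipe_stepP; exists (val p), (val q); split=> //; right.
    by rewrite he Cpq.
  have [e he] : exists e, grid_coord e = (false, val p, val q).
    by apply/in_gridP => /=; lia.
  apply: (base e) => //; last by rewrite he /mu /=; lia.
  apply/pipe_stepP; exists (val p), (val q); split=> //; left.
  by rewrite he Cpq.
- have hp := ltn_ord p; have := ltn_ord q; rewrite ltnS.
  case Eq: (val q) => [|q'] hq.
    exists (left_entry p) => //; first by left; exists p.
    rewrite (_ : inr _ = left_entry p) ?connect0 //.
    by apply: grid_coord_inj; rewrite /= Eq.
  case Cpq: (C p q').
    have [e he] : exists e, grid_coord e = (false, val p, q').
      by apply/in_gridP => /=; lia.
    apply: (base e) => //; last by rewrite he /mu /= Eq; lia.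
    apply/pipe_stepP; exists (val p), q'; split=> //; left.
    by rewrite he Cpq /= Eq.
  have [e he] : exists e, grid_coord e = (true, p.+1, q').
    by apply/in_gridP => /=; lia.
  apply: (base e) => //; last by rewrite he /mu /= Eq; lia.
  apply/pipe_stepP; exists (val p), q'; split=> //; right.
  by rewrite he Cpq /= Eq.
Qed.

Lemma reach_line p q q' : reach (true, p, q) (true, p, q') -> q = q'.
Proof.
case=> e [f [he hf /connectP[s]]].
case: s => [|x s] /=; first by move=> _ fe; move: hf; rewrite fe he => -[].
case/andP=> st ps fx; exfalso.
(* Twice the line number, plus one for a vertical edge: [ht] never grows along a pipe and drops
   strictly when a horizontal edge is left, so a line cannot be met twice. *)
pose ht (x : bool * nat * nat) := x.1.2.*2 + ~~ x.1.1.
have mono a b : pipe_step pipes_of a b -> ht (grid_coord b) <= ht (grid_coord a).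
  by case/pipe_stepP => [i [j [_ _ [[-> ->]|[-> ->]]]]]; case: ifP => _; rewrite /ht /=; lia.
have lt : ht (grid_coord x) < p.*2.
  case/pipe_stepP: st => [i [j [_ _]]]; rewrite he.
  by case=> -[[]] // -> _ ->; case: ifP => _; rewrite /ht /=; lia.
have : ht (grid_coord f) <= ht (grid_coord x).
  rewrite fx; elim: s x ps {st fx lt} => //= y s IH x /andP[st ps].
  exact: leq_trans (IH _ ps) (mono _ _ st).
by rewrite hf {1}/ht /=; lia.
Qed.

Lemma pipes_reach P e f : P \in pipes pipes_of -> e \in P -> f \in P ->
  reach (grid_coord e) (grid_coord f) \/ reach (grid_coord f) (grid_coord e).
Proof.
case/pipesP => x _ ->; rewrite !inE => xe xf.
by case: (connect_total xe xf) => h; [left; exists e, f|right; exists f, e].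
Qed.

Lemma pipes_closed P e f : P \in pipes pipes_of -> e \in P ->
  reach (grid_coord e) (grid_coord f) -> f \in P.
Proof.
case/pipesP => x _ ->; rewrite !inE => xe [e' [f' [/grid_coord_inj ee' /grid_coord_inj ff' h]]].
by subst; apply: connect_trans xe h.
Qed.

Lemma pipes_eq P Q f : P \in pipes pipes_of -> Q \in pipes pipes_of ->
  f \in P -> f \in Q -> P = Q.
Proof.
move=> /pipesP[e ent ->] /pipesP[e' ent' ->]; rewrite !inE => h h'.
by rewrite (connect_entry_inj ent ent' h h').
Qed.

Lemma left_pipe_inj p p' f : f \in pipe pipes_of (left_entry p) ->
  f \in pipe pipes_of (left_entry p') -> p = p'.
Proof.
rewrite !inE => h h'.
have ent x : entry (left_entry x) by left; exists x.
by have [] := connect_entry_inj (ent p) (ent p') h h'.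
Qed.

Lemma mem_left_pipe (p : 'I_d) f : reach (false, val p, 0) (grid_coord f) ->
  f \in pipe pipes_of (left_entry p).
Proof.
case=> e [g [he /grid_coord_inj -> h]]; rewrite inE.
suff <- : e = left_entry p by [].
by apply: grid_coord_inj; rewrite he.
Qed.

(** * Inversions, crosses and reducedness *)

Section Exit.

Variable u : 'S_d.
Hypothesis uE : forall p, u p = column_at 0 p :> nat.

Let inv_set := [set p : 'I_d * 'I_d | (p.1 < p.2) && (u p.2 < u p.1)].
Let cross_set := [set b : 'I_d * 'I_d | C b.1 b.2].
Let meet (x b : 'I_d * 'I_d) :=
  [&& b \in cross_set, left_edge b \in pipe pipes_of (left_entry x.1)
    & bottom_edge b \in pipe pipes_of (left_entry x.2)].
(** The default [x] only has the right type; on inversions the pick succeeds by [meetingP]. *)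
Let meeting x := odflt x [pick b | meet x b].

Let meetingP x : x \in inv_set -> meet x (meeting x).
Proof.
case: x => p p'; rewrite inE /= => /andP[lt].
rewrite !uE => lt'.
have [_ []] := @column_at_order 0 p p' lt (ltn_ord p'); first lia.
rewrite !add0n => -[a [b [ha hb Cab r1 r2]]].
rewrite /meeting; case: pickP => //= /(_ (Ordinal ha, Ordinal hb)) /negP[].
rewrite /meet !inE Cab /= -[X in X && _]in_set -[X in _ && X]in_set.
apply/andP; split.
  by have := @mem_left_pipe p (left_edge (Ordinal ha, Ordinal hb)); rewrite inE; apply.
have := @mem_left_pipe p' (bottom_edge (Ordinal ha, Ordinal hb)); rewrite inE; apply.
by rewrite /= /bump leq0n add1n.
Qed.

(** The pipes through the left and the bottom edge of a box determine their entries, so the box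
    gives the inversion back. *)
Let meeting_inj : {in inv_set &, injective meeting}.
Proof.
move=> [p p'] [q q'] /meetingP /and3P[_ h1 h2] /meetingP /and3P[_ h3 h4] e.
by rewrite -e /= in h1 h2 h3 h4; rewrite (left_pipe_inj h1 h3) (left_pipe_inj h2 h4).
Qed.

Let meeting_sub : meeting @: inv_set \subset cross_set.
Proof. by apply/subsetP => _ /imsetP[x /meetingP /and3P[h _ _] ->]. Qed.

Lemma inversions_le_crosses : inversions u <= #|cross_set|.
Proof. by rewrite -[inversions u](card_in_imset meeting_inj) subset_leq_card. Qed.

(** With this bound [meeting] is onto the crosses, so each cross comes from one inversion. A second
    cross of the same two pipes would come from the same pair or from the reversed pair, which is
    not an inversion. *)
Lemma reduced_of_card : #|cross_set| <= inversions u -> pipes_of \in RC u.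
Proof.
move=> le; have meetE : meeting @: inv_set = cross_set.
  by apply/eqP; rewrite eqEcard meeting_sub card_in_imset.
rewrite inE; apply/andP; split; first (apply/andP; split).
- apply/forallP => p; apply/forallP => q; apply/implyP => h; rewrite mxE.
  by apply/negP => /C_tri; lia.
- apply/forallP => p; apply: mem_left_pipe; rewrite /= uE.
  by apply: (@reach_column_at 0); rewrite add0n.
apply/forall_inP => P hP; apply/forall_inP => Q hQ; apply/implyP => PQ.
have left_in x : pipe pipes_of (left_entry x) \in pipes pipes_of.
  by apply/pipesP; exists (left_entry x) => //; left; exists x.
have main b : b \in crossings pipes_of P Q -> exists x, [/\ x \in inv_set, b = meeting x &
    P = pipe pipes_of (left_entry x.1) /\ Q = pipe pipes_of (left_entry x.2) \/
    Q = pipe pipes_of (left_entry x.1) /\ P = pipe pipes_of (left_entry x.2)].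
  rewrite inE mxE => /andP[Cb h].
  have : b \in meeting @: inv_set by rewrite meetE inE.
  case/imsetP => x xi bx; exists x; split=> //.
  have /and3P[_] := meetingP xi; rewrite -bx => h1 h2.
  by case/orP: h => /andP[h3 h4]; [left|right]; split;
    [exact: (pipes_eq hP (left_in _) h3 h1)|exact: (pipes_eq hQ (left_in _) h4 h2)
    |exact: (pipes_eq hQ (left_in _) h3 h1)|exact: (pipes_eq hP (left_in _) h4 h2)].
have linj x y : pipe pipes_of (left_entry x) = pipe pipes_of (left_entry y) -> x = y.
  move=> e; apply: (@left_pipe_inj x y (left_entry x)); last rewrite -e.
    by rewrite inE connect0.
  by rewrite inE connect0.
rewrite leqNgt; apply/negP => /card_gt1P[b [b' [hb hb' /eqP]]]; apply.
have [[p p'] [pi -> e]] := main b hb; have [[q q'] [qi -> e']] := main b' hb'.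
rewrite /= in e e'.
have : (p, p') = (q, q') \/ (p, p') = (q', q).
  by case: e e' => -[-> ->] [] [/linj -> /linj ->]; [left|right|right|left].
case=> [->//|[ep ep']]; subst.
by move: pi qi; rewrite !inE /=; lia.
Qed.

End Exit.

End RowMap.

(** * The pipe dream of a lacing diagram *)

Section BlockCoordinates.

Variables (n : nat) (r : nat -> nat -> nat).

(* First column of the block M_(i, n-i); the columns from [first_col k] to
   [first_col k + r k k - 1] carry the vertices of column k of the lacing
   diagrams, numbered from right to left. *)
Definition first_col (k : nat) : nat := block_col n r (n - k).

(** Block row [i] carries the vertices of column [i] as well, numbered from the bottom up. *)
Definition vertex_row (i s : nat) : nat := block_row r i.+1 - s.+1.
Definition vertex_col (k t : nat) : nat := first_col k + r k k - t.+1.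

(** Width of the block M_(i, n-i-1). The value 0 for [i = n] agrees with [first_col n.+1 = 0], an
    effect of truncated subtraction, and lets the last block row be treated like the others. *)
Definition width (i : nat) : nat := if i < n then r i.+1 i.+1 else 0.

Lemma block_rowS i : block_row r i.+1 = block_row r i + r i i.
Proof. by rewrite /block_row big_ord_recr. Qed.

Lemma first_colE i : i <= n -> first_col i = first_col i.+1 + width i.
Proof.
rewrite /first_col /width => le; case: ltnP => h; last first.
  have -> : n - i = 0 by lia.
  by have -> : n - i.+1 = 0; [lia | rewrite addn0].
have -> : n - i = (n - i.+1).+1 by lia.
rewrite /block_col big_ord_recr /=; congr (_ + _).
by rewrite subKn.
Qed.

Lemma first_col_last : first_col n = 0.
Proof. by rewrite /first_col subnn /block_col big_ord0. Qed.

(** The block columns repeat the sizes of the block rows in reverse, so the lower right corners of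
    the superantidiagonal blocks lie on the antidiagonal of the grid. *)
Lemma block_row_first_col i : i <= n -> block_row r i.+1 + first_col i = total_dim n r.
Proof.
move=> le; rewrite -(subKn le); elim: (n - i) (leq_subr i n) => [|j IH] hj.
  by rewrite subn0 first_col_last addn0.
have := IH (ltnW hj); have -> : n - j = (n - j.+1).+1 by lia.
rewrite block_rowS; have := @first_colE (n - j.+1); rewrite /width.
by rewrite ifT; lia.
Qed.

Definition row_block (p : nat) : nat := find (fun i => p < block_row r i.+1) (iota 0 n.+1).
(** Block columns are labelled by columns of the lacing diagram. The labels decrease from left to
    right, hence the reversal in [col_block_mono]. *)
Definition col_block (q : nat) : nat := find (fun k => first_col k <= q) (iota 0 n.+1).

Lemma block_row_mono i i' : i <= i' -> block_row r i <= block_row r i'.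
Proof.
elim: i' => [|i' IH]; first by case: i.
by rewrite leq_eqVlt => /orP[/eqP ->//|/IH]; rewrite block_rowS; lia.
Qed.

Lemma first_col_mono i i' : i <= i' -> i' <= n -> first_col i' <= first_col i.
Proof.
elim: i' => [|i' IH]; first by case: i.
rewrite leq_eqVlt => /orP[/eqP->//|] h1 h2; have := IH h1 (ltnW h2).
by have := @first_colE i'; lia.
Qed.

Lemma row_blockP p : p < total_dim n r ->
  row_block p <= n /\ block_row r (row_block p) <= p < block_row r (row_block p).+1.
Proof.
move=> hp; have h : has (fun i => p < block_row r i.+1) (iota 0 n.+1).
  apply/hasP; exists n; first by rewrite mem_iota; lia.
  by have := @block_row_first_col n; rewrite first_col_last; lia.
have lt := h; rewrite has_find size_iota -/(row_block p) in lt.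
have := nth_find 0 h; rewrite nth_iota // -/(row_block p) add0n => h1.
split=> //; rewrite h1 andbT leqNgt; apply/negP => h2.
case E: (row_block p) h2 => [|i]; first by rewrite /block_row big_ord0.
have /(before_find 0) : i < row_block p by rewrite E.
by rewrite nth_iota ?add0n; [move=> -> | lia].
Qed.

Lemma row_block_eq i p : i <= n -> block_row r i <= p < block_row r i.+1 -> row_block p = i.
Proof.
move=> hi hp; have pd : p < total_dim n r by have := block_row_first_col hi; lia.
have [h1 h2] := row_blockP pd.
by case: (ltngtP (row_block p) i) => // /block_row_mono; lia.
Qed.

Lemma first_col_end k : k <= n -> first_col k + r k k <= total_dim n r.
Proof. by move=> /block_row_first_col; rewrite block_rowS; lia. Qed.

Lemma col_blockP q : q < total_dim n r -> col_block q <= n /\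
  first_col (col_block q) <= q < first_col (col_block q) + r (col_block q) (col_block q).
Proof.
move=> hq; have h : has (fun k => first_col k <= q) (iota 0 n.+1).
  by apply/hasP; exists n; rewrite ?first_col_last // mem_iota; lia.
have lt := h; rewrite has_find size_iota -/(col_block q) in lt.
have := nth_find 0 h; rewrite nth_iota // -/(col_block q) add0n => h1.
split=> //; rewrite h1.
case E: (col_block q) lt => [|k] lt.
  have := @block_row_first_col 0; rewrite block_rowS /block_row big_ord0; lia.
have /(before_find 0) : k < col_block q by rewrite E.
rewrite nth_iota ?add0n => [h2|]; last by lia.
by have := @first_colE k; rewrite /width ifT; lia.
Qed.

Lemma col_block_eq k q : k <= n -> first_col k <= q < first_col k + r k k -> col_block q = k.
Proof.
move=> hk hq; have qd : q < total_dim n r by have := first_col_end hk; lia.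
have [h1 h2] := col_blockP qd.
have main a b : a < b -> b <= n -> first_col b + r b b <= first_col a.
  move=> ab bn; case: b ab bn => // b ab bn.
  by have := @first_colE b; have := @first_col_mono a b; rewrite /width ifT; lia.
by case: (ltngtP (col_block q) k) => // /main; lia.
Qed.

Lemma row_block_mono p p' : p <= p' -> p' < total_dim n r -> row_block p <= row_block p'.
Proof.
move=> le lt; have [h1 h2] := row_blockP (leq_ltn_trans le lt); have [h3 h4] := row_blockP lt.
by case: leqP => // /block_row_mono; lia.
Qed.

Lemma col_block_mono q q' : q <= q' -> q' < total_dim n r -> col_block q' <= col_block q.
Proof.
move=> le lt; have [h1 h2] := col_blockP (leq_ltn_trans le lt); have [h3 h4] := col_blockP lt.
case: (ltngtP (col_block q) (col_block q')) => // h.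
have := @first_colE (col_block q').-1; rewrite prednK; last by lia.
have := @first_col_mono (col_block q) (col_block q').-1.
by rewrite /width ifT; [|lia]; rewrite prednK; lia.
Qed.

End BlockCoordinates.

(** * Climbing through the block rows *)

Section Blocks.

Variables (n : nat) (r : nat -> nat -> nat) (edge : nat -> nat -> nat -> bool).
Hypothesis edge_dom : forall i s t, edge i s t -> [/\ i < n, s < r i i & t < r i.+1 i.+1].
Hypothesis edge_fun : forall i s t t', edge i s t -> edge i s t' -> t = t'.
Hypothesis edge_inj : forall i s s' t, edge i s t -> edge i s' t -> s = s'.

Notation d := (total_dim n r).
Notation first_col := (first_col n r).
Notation vertex_row := (vertex_row r).
Notation vertex_col := (vertex_col n r).
Notation width := (width n r).

(* [target i s] is [width i] if no edge leaves vertex [s] of column [i] to the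
   right; with this convention [code i] lists the Lehmer code of the minimal
   length embedding of [edge i], see [sum_code]. *)
Definition target (i s : nat) : nat := find (edge i s) (iota 0 (width i)).
Definition remaining (i s t : nat) : bool := ~~ has (edge i ^~ t) (iota 0 s).
Definition rank_remaining (i s t : nat) : nat := count (remaining i s) (iota 0 t).
Definition code (i s : nat) : nat := rank_remaining i s (target i s).

Lemma edgeW i s t : edge i s t -> t < width i.
Proof. by case/edge_dom => hi _ ht; rewrite /width hi. Qed.

Lemma target_le i s : target i s <= width i.
Proof. by have := find_size (edge i s) (iota 0 (width i)); rewrite size_iota. Qed.

Lemma edge_target i s t : edge i s t -> target i s = t.
Proof.
move=> h; have hw := edgeW h.
have hh : has (edge i s) (iota 0 (width i)) by apply/hasP; exists t; rewrite ?mem_iota.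
have lt := hh; rewrite has_find size_iota in lt.
have := nth_find 0 hh; rewrite nth_iota // add0n => h'.
exact: edge_fun h' h.
Qed.

Lemma target_edge i s : target i s < width i -> edge i s (target i s).
Proof.
move=> lt; have hh : has (edge i s) (iota 0 (width i)) by rewrite has_find size_iota.
by have := nth_find 0 hh; rewrite nth_iota.
Qed.

Lemma edgeE i s t : t < width i -> edge i s t = (target i s == t).
Proof.
move=> tw; apply/idP/eqP => [/edge_target //|e]; rewrite -e.
by apply: target_edge; rewrite e.
Qed.

Lemma remainingS i s t : remaining i s.+1 t = remaining i s t && ~~ edge i s t.
Proof. by rewrite /remaining -addn1 iotaD has_cat /= orbF negb_or add0n. Qed.

Lemma edge_remaining i s t : edge i s t -> remaining i s t.
Proof.
move=> h; apply/hasPn => s'; rewrite mem_iota => hs.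
by apply/negP => h'; have := edge_inj h h'; lia.
Qed.

Lemma rank_remaining0 i t : rank_remaining i 0 t = t.
Proof.
rewrite /rank_remaining (eq_count (a2 := predT)) ?count_predT ?size_iota //.
Qed.

Lemma rank_remaining_le i s t : rank_remaining i s t <= t.
Proof. by rewrite -[leqRHS](size_iota 0) count_size. Qed.

Lemma rank_remaining_lt i s t t' : remaining i s t -> t < t' ->
  rank_remaining i s t < rank_remaining i s t'.
Proof.
move=> ht lt; rewrite /rank_remaining -(subnKC lt) iotaD count_cat -[t.+1]addn1 iotaD.
by rewrite count_cat /= add0n ht; lia.
Qed.

(** Step [s] uses up only the target of [s]; without an edge the target is [width i], and
    [t <= width i] makes the correction vanish. *)
Lemma rank_remainingS i s t : t <= width i ->
  rank_remaining i s.+1 t + ((target i s < t) : nat) = rank_remaining i s t.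
Proof.
move=> tw; rewrite /rank_remaining.
rewrite (eq_count (a2 := predI (remaining i s) (predC (edge i s)))); last first.
  by move=> x; rewrite /= remainingS.
have -> : ((target i s < t) : nat) = count (predI (remaining i s) (edge i s)) (iota 0 t).
  rewrite (eq_in_count (a2 := pred1 (target i s))).
    by rewrite count_uniq_mem ?iota_uniq // mem_iota.
  move=> x; rewrite mem_iota add0n => /andP[_ xt] /=.
  rewrite [x == _]eq_sym -edgeE ?andb_idl //; first exact: edge_remaining.
  exact: leq_trans xt tw.
rewrite addnC -count_predUI.
rewrite [count (predI (predI _ _) _) _](_ : _ = 0) ?addn0.
  by apply: eq_count => x /=; case: (remaining i s x); case: (edge i s x).
apply/eqP; rewrite -leqn0 leqNgt -has_count; apply/hasPn => x _ /=.
by case: (edge i s x); rewrite ?andbF.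
Qed.

Lemma code_le i s : code i s <= width i.
Proof. exact: leq_trans (rank_remaining_le _ _ _) (target_le _ _). Qed.

(* In the block M_(i, n-i-1), row s from the bottom has its [code i s]
   rightmost boxes crossed: rotated by a half turn, the block is the bottom
   pipe dream of the partial permutation [edge i]. *)
Definition cross (p q : nat) : bool :=
  let i := row_block n r p in
  (p < d) && ((q < first_col i.+1) ||
    (first_col i - code i (block_row r i.+1 - p.+1) <= q < first_col i)).

Lemma crossE i s q : i <= n -> s < r i i -> cross (vertex_row i s) q =
  (q < first_col i.+1) || (first_col i - code i s <= q < first_col i).
Proof.
move=> hi hs; have e := block_row_first_col r hi; have e' := block_rowS r i.
rewrite /cross (@row_block_eq n r i) //; last by rewrite /vertex_row; lia.
have -> : block_row r i.+1 - (vertex_row i s).+1 = s by rewrite /vertex_row; lia.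
by rewrite (_ : vertex_row i s < d) //; rewrite /vertex_row; lia.
Qed.

Lemma cross_triangular p q : cross p q -> p + q + 2 <= d.
Proof.
case/andP=> pd h; have [h1 h2] := row_blockP pd.
have := block_row_first_col r h1; have := first_colE r h1.
by case/orP: h; lia.
Qed.

Notation row_map := (row_map d cross).
Notation next_elbow := (next_elbow d cross).
Notation rise := (rise d cross).
Notation column_at := (column_at d cross).

Lemma row_map_left i s q : i <= n -> s < r i i -> q < first_col i.+1 ->
  row_map (vertex_row i s) q = q.
Proof. by move=> hi hs hq; rewrite /row_map crossE // hq. Qed.

Lemma row_map_cross i s q : i <= n -> s < r i i -> first_col i - code i s <= q < first_col i ->
  row_map (vertex_row i s) q = q.
Proof. by move=> hi hs hq; rewrite /row_map crossE // hq orbT. Qed.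

Lemma row_map_right i s q : i <= n -> s < r i i -> first_col i <= q ->
  row_map (vertex_row i s) q = q.+1.
Proof.
move=> hi hs hq; have h := first_colE r hi.
rewrite /row_map crossE // ifF; last by lia.
apply: (next_elbow_eq cross_triangular) => //; last by move=> z; lia.
by rewrite crossE //; lia.
Qed.

Lemma row_map_elbow i s q : i <= n -> s < r i i ->
    first_col i.+1 <= q -> q.+1 < first_col i - code i s ->
  row_map (vertex_row i s) q = q.+1.
Proof.
move=> hi hs h1 h2.
rewrite /row_map crossE // ifF; last by lia.
apply: (next_elbow_eq cross_triangular) => //; last by move=> z; lia.
by rewrite crossE //; lia.
Qed.

(** From the last elbow before the crossed boxes a pipe turns right and is carried over all of them,
    into the first column of the antidiagonal block. *)
Lemma row_map_exit i s q : i <= n -> s < r i i ->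
    first_col i.+1 <= q -> q.+1 = first_col i - code i s ->
  row_map (vertex_row i s) q = first_col i.
Proof.
move=> hi hs h1 h2.
rewrite /row_map crossE // ifF; last by lia.
apply: (next_elbow_eq cross_triangular) => //; first lia.
  by rewrite crossE //; lia.
by move=> z hz; rewrite crossE //; lia.
Qed.

Lemma next_elbow_vertex_row i s : i <= n -> s < r i i ->
  next_elbow (vertex_row i s) 0 =
    if code i s < width i then first_col i.+1 else first_col i.
Proof.
move=> hi hs; have h := first_colE r hi; have := code_le i s.
by case: ifP => hc hc'; apply: (next_elbow_eq cross_triangular) => //;
  [rewrite crossE //; lia|move=> z hz; rewrite crossE //; lia
  |rewrite crossE //; lia|move=> z hz; rewrite crossE //; lia].
Qed.

Lemma row_map_block i s q : i <= n -> s < r i i -> first_col i.+1 <= q < first_col i ->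
  first_col i.+1 <= row_map (vertex_row i s) q < first_col i \/
  row_map (vertex_row i s) q = first_col i.
Proof.
move=> hi hs hq; have h := first_colE r hi; have hc := code_le i s.
case: (leqP (first_col i - code i s) q) => h1; first by rewrite row_map_cross; lia.
case: (ltngtP q.+1 (first_col i - code i s)) => h2; last by rewrite row_map_exit; lia.
  by rewrite row_map_elbow; lia.
lia.
Qed.

Lemma vertex_row_line i m : m < r i i ->
  (block_row r i.+1 - m = (vertex_row i m).+1) /\ block_row r i.+1 - m.+1 = vertex_row i m.
Proof. by rewrite /vertex_row; have := block_rowS r i; lia. Qed.

(** The pipes of the vertices still unmatched stay packed against the right side of the block. In
    row [m] those of rank below [code i m] go straight up through crosses, the one of that rank
    leaves if [m] has an edge, and those of larger rank move right by one and close the gap. *)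
Lemma rise_remaining i m t : i <= n -> t < width i -> m <= r i i -> remaining i m t ->
  rise m (block_row r i.+1 - m) (first_col i - t.+1) = first_col i - (rank_remaining i m t).+1.
Proof.
move=> hi ht; elim: m => [|m IH] hm; first by rewrite rank_remaining0.
rewrite remainingS => /andP[rm ne].
have [e1 e2] := vertex_row_line hm.
have hw := first_colE r hi.
have hr := rank_remaining_le i m t.
have tS : rank_remaining i m.+1 t + ((target i m < t) : nat) = rank_remaining i m t.
  by apply: rank_remainingS; exact: ltnW.
rewrite /= e2 -e1 IH //; last exact: ltnW.
case: (ltngtP (target i m) t) tS => h tS.
- have ed := target_edge (ltn_trans h ht).
  have := rank_remaining_lt (edge_remaining ed) h.
  rewrite -/(code i m) => lt.
  by rewrite row_map_elbow //; lia.
- have := rank_remaining_lt rm h; rewrite -/(code i m) => lt.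
  by rewrite row_map_cross //; lia.
- by move: ne; rewrite edgeE // h eqxx.
Qed.

Lemma rise_exit i s t : edge i s t ->
  rise s.+1 (vertex_row i s) (first_col i - t.+1) = first_col i.
Proof.
move=> ed; have [hi hs _] := edge_dom ed; have hw := edgeW ed.
have hn := ltnW hi.
have [e1 e2] := vertex_row_line hs.
have h := first_colE r hn; have hr := rank_remaining_le i s t.
rewrite /= -e1 rise_remaining ?edge_remaining //; last exact: ltnW.
by rewrite -(edge_target ed) -/(code i s) in hw hr *; rewrite row_map_exit //; lia.
Qed.

Lemma rise_right i m k q : i <= n -> m + k <= r i i -> first_col i <= q ->
  rise k (block_row r i + m) q = q + k.
Proof.
move=> hi; elim: k m => [|k IH] m hm hq /=; first by rewrite addn0.
rewrite -addnS IH //; last by lia.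
have -> : block_row r i + m = vertex_row i (r i i - m.+1).
  by rewrite /vertex_row; have := block_rowS r i; lia.
by rewrite row_map_right //; lia.
Qed.

(** Having left the block in row [s], the pipe moves right by one column in each of the
    [r i i - s.+1] rows above, among the elbows of the antidiagonal block, and so arrives at vertex
    [s]. *)
Lemma rise_edge i s t : edge i s t ->
  rise (r i i) (block_row r i) (first_col i - t.+1) = vertex_col i s.
Proof.
move=> ed; have [hi hs _] := edge_dom ed.
have -> : r i i = (r i i - s.+1) + s.+1 by lia.
rewrite riseD.
have -> : block_row r i + (r i i - s.+1) = vertex_row i s.
  by rewrite /vertex_row; have := block_rowS r i; lia.
rewrite rise_exit // -[block_row r i]addn0 (@rise_right i) //; try lia.
by rewrite /vertex_col; lia.
Qed.

Lemma rise_no_edge i t : i < n -> t < r i.+1 i.+1 -> (forall s, ~~ edge i s t) ->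
  first_col i.+1 <= rise (r i i) (block_row r i) (first_col i - t.+1) < first_col i.
Proof.
move=> hi ht ne; have hn := ltnW hi.
have hw : width i = r i.+1 i.+1 by rewrite /width hi.
have h := first_colE r hn.
have := @rise_remaining i (r i i) t hn; rewrite hw block_rowS addnK => -> //; last first.
  by apply/hasPn => s _; exact: ne.
have := rank_remaining_le i (r i i) t; lia.
Qed.

Lemma rise_left_block i q : i <= n -> q < first_col i.+1 ->
  rise (r i i) (block_row r i) q = q.
Proof.
move=> hi hq; suff L k m : m + k <= r i i -> rise k (block_row r i + m) q = q.
  by have := L (r i i) 0; rewrite add0n addn0; apply.
elim: k m => //= k IH m hm; rewrite -addnS IH //; last by lia.
have -> : block_row r i + m = vertex_row i (r i i - m.+1).
  by rewrite /vertex_row; have := block_rowS r i; lia.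
by rewrite row_map_left //; lia.
Qed.

Lemma rise_left i q : i <= n.+1 -> q < first_col i -> rise (block_row r i) 0 q = q.
Proof.
elim: i => [|i IH] hi hq; first by rewrite /block_row big_ord0.
rewrite block_rowS riseD add0n rise_left_block //.
by apply: IH; [exact: ltnW|have := first_colE r (_ : i <= n); lia].
Qed.

Lemma column_at_block i s : i <= n -> s < r i i ->
  first_col i.+1 <= column_at (block_row r i) (r i i - s.+1) < first_col i \/
  exists2 s', s' < r i i & column_at (block_row r i) (r i i - s.+1) = vertex_col i s' /\
    forall t, ~~ edge i s' t.
Proof.
move=> hi hs; set m := r i i - s.+1.
have row k : k <= m -> block_row r i + (m - k) = vertex_row i (s + k).
  by rewrite /vertex_row /m; have := block_rowS r i; lia.
(* Here [s'] is the row in which the pipe gets past the superantidiagonal block; from then on it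
   moves right by one column per row. *)
have L k : k <= m ->
   first_col i.+1 <= column_at (block_row r i + (m - k)) k < first_col i \/
   exists2 s', s <= s' <= s + k &
     column_at (block_row r i + (m - k)) k = first_col i + (s + k - s').
  elim: k => [|k IH] hk.
    have hw := first_colE r hi; rewrite row // addn0.
    rewrite /column_at /= addn0 next_elbow_vertex_row //.
    by case: ifP => hc; [left; lia|right; exists s; lia].
  have hs' : s + k.+1 < r i i by rewrite /m in hk; lia.
  rewrite column_atS; have -> : (block_row r i + (m - k.+1)).+1 = block_row r i + (m - k) by lia.
  rewrite row //; case: (IH (ltnW hk)) => [h|[s' h1 h2]].
    case: (row_map_block hi hs' h) => [|->]; first by left.
    by right; exists (s + k.+1); lia.
  right; exists s'; first lia.
  by rewrite h2 row_map_right //; lia.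
have := L m (leqnn m); rewrite subnn addn0 => -[|[s' h1 h2]]; [by left|right].
exists s'; first by rewrite /m in h1; lia.
have ev : column_at (block_row r i) m = vertex_col i s'.
  by rewrite h2 /vertex_col /m; rewrite /m in h1; lia.
split=> // t; apply/negP => ed.
(* An edge at [s'] would bring a pipe from below to the same column. Cancelling the common rows by
   injectivity leaves two pipes that leave one row in one column, one entering it from the left side
   and one from below. *)
have := rise_edge ed; rewrite -ev /column_at.
have e : r i i = m + s.+1 by rewrite /m; lia.
rewrite [in X in rise X _ _]e riseD => /(@rise_inj _ _ cross_triangular _ _) /= E.
have := next_elbow_row_map_neq cross_triangular (block_row r i + m)
  (rise s (block_row r i + m).+1 (first_col i - t.+1)).
by rewrite E eqxx.
Qed.

Definition source (i t : nat) : nat := find (edge i ^~ t) (iota 0 (r i i)).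

(* The column containing the left end of the lace through vertex [t] of
   column [k]. *)
Fixpoint left_end (k t : nat) : nat :=
  if k is i.+1 then
    if source i t < r i i then left_end i (source i t) else k
  else 0.

Lemma edge_source i s t : edge i s t -> source i t = s.
Proof.
move=> ed; have [_ hs _] := edge_dom ed.
have hh : has (edge i ^~ t) (iota 0 (r i i)) by apply/hasP; exists s; rewrite ?mem_iota.
have lt := hh; rewrite has_find size_iota in lt.
have := nth_find 0 hh; rewrite nth_iota // add0n => h'.
exact: edge_inj h' ed.
Qed.

Lemma source_edge i t : source i t < r i i -> edge i (source i t) t.
Proof.
move=> lt; have hh : has (edge i ^~ t) (iota 0 (r i i)) by rewrite has_find size_iota.
by have := nth_find 0 hh; rewrite nth_iota.
Qed.

Lemma left_end_edge i s t : edge i s t -> left_end i.+1 t = left_end i s.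
Proof. by move=> ed; have [_ hs _] := edge_dom ed; rewrite /= (edge_source ed) hs. Qed.

Lemma left_end_le k t : left_end k t <= k.
Proof. by elim: k t => //= i IH t; case: ifP => // _; apply: leq_trans (IH _) _. Qed.

Lemma rise_vertex k t : k <= n -> t < r k k ->
  first_col (left_end k t) <= rise (block_row r k) 0 (vertex_col k t)
    < first_col (left_end k t) + r (left_end k t) (left_end k t).
Proof.
elim: k t => [|i IH] t hi ht.
  by rewrite /block_row big_ord0 /= /vertex_col; lia.
have hw : width i = r i.+1 i.+1 by rewrite /width hi.
have h := first_colE r (ltnW hi).
have ev : vertex_col i.+1 t = first_col i - t.+1 by rewrite /vertex_col; lia.
rewrite block_rowS riseD add0n ev /=; case: ifP => hs.
  by rewrite (rise_edge (source_edge hs)); apply: IH => //; exact: ltnW.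
have ne s : ~~ edge i s t.
  apply/negP => ed; have [_ lt _] := edge_dom ed.
  by rewrite (edge_source ed) lt in hs.
have := rise_no_edge hi ht ne => hh; rewrite rise_left //; lia.
Qed.

Definition terminal (i s : nat) : bool := target i s == width i.

Lemma exit_block i s : i <= n -> s < r i i ->
    col_block n r (column_at 0 (vertex_row i s)) = i.+1 /\ i < n \/
  exists s', [/\ s' < r i i, terminal i s',
    column_at (block_row r i) (r i i - s.+1) = vertex_col i s' &
    col_block n r (column_at 0 (vertex_row i s)) = left_end i s'].
Proof.
move=> hi hs.
have -> : vertex_row i s = block_row r i + (r i i - s.+1).
  by rewrite /vertex_row; have := block_rowS r i; lia.
rewrite column_atD add0n; case: (column_at_block hi hs) => [h|[s' h1 [h2 h3]]].
  left; have hw := first_colE r hi.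
  have lt : i < n by move: hw; rewrite /width; case: ltnP; lia.
  split=> //; rewrite rise_left; [|lia|lia].
  by apply: col_block_eq => //; rewrite /width lt in hw; lia.
right; exists s'; split=> //.
  rewrite /terminal eqn_leq target_le /= leqNgt; apply/negP => /target_edge.
  by apply/negP.
rewrite h2; apply: col_block_eq (rise_vertex hi h1).
exact: leq_trans (left_end_le _ _) hi.
Qed.

End Blocks.

(** * Laces *)

Section Laces.

Variables (n : nat) (r : nat -> nat -> nat) (W : lacing n r).
Hypothesis W_pp : forall k, partial_perm (W k).

(** A relation on plain numbers frees the block arguments from the dependent type of [W]. *)
Definition edge (i s t : nat) : bool :=
  [exists k : 'I_n, exists a : 'I_(r k k), exists b : 'I_(r k.+1 k.+1),
    [&& W k a b, i == k, s == a & t == b]].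

Lemma edgeP (i s t : nat) : reflect
  (exists (k : 'I_n) (a : 'I_(r k k)) (b : 'I_(r k.+1 k.+1)),
     [/\ W k a b, i = k :> nat, s = a :> nat & t = b :> nat]) (edge i s t).
Proof.
apply: (iffP existsP) => -[k].
  case/existsP=> a /existsP[b /and4P[h /eqP -> /eqP -> /eqP ->]].
  by exists k, a, b.
case=> a [b [h -> -> ->]]; exists k; apply/existsP; exists a; apply/existsP.
by exists b; rewrite h !eqxx.
Qed.

Lemma edge_ord (k : 'I_n) (a : 'I_(r k k)) (b : 'I_(r k.+1 k.+1)) : edge k a b = W k a b.
Proof.
apply/edgeP/idP => [[k' [a' [b' [h /val_inj ek]]]]|h]; last by exists k, a, b.
by subst k' => /val_inj -> /val_inj ->.
Qed.

Lemma edge_dom i s t : edge i s t -> [/\ i < n, s < r i i & t < r i.+1 i.+1].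
Proof. by case/edgeP => k [a [b [_ -> -> ->]]]; split. Qed.

Lemma edge_fun i s t t' : edge i s t -> edge i s t' -> t = t'.
Proof.
case/edgeP=> k [a [b [h -> -> ->]]] e; have [_ _ h'] := edge_dom e.
have {}e := e : edge k a (Ordinal h'); rewrite edge_ord in e.
have /andP[/forallP /(_ a) /card_le1_eqP le _] := W_pp k.
by rewrite [b](le (Ordinal h') b) // inE.
Qed.

Lemma edge_inj i s s' t : edge i s t -> edge i s' t -> s = s'.
Proof.
case/edgeP=> k [a [b [h -> -> ->]]] e; have [_ h' _] := edge_dom e.
have {}e := e : edge k (Ordinal h') b; rewrite edge_ord in e.
have /andP[_ /forallP /(_ b) /card_le1_eqP le] := W_pp k.
by rewrite [a](le (Ordinal h') a) // inE.
Qed.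

Lemma lacing_edgeE x y : lacing_edge W x y =
  edge (tag x) (tagged x) (tagged y) && (tag y == (tag x).+1 :> nat).
Proof.
apply/existsP/andP => [[k /existsP[a /existsP[b /and5P[h /eqP e1 /eqP e2 /eqP e3 /eqP e4]]]]|].
  by split; [apply/edgeP; exists k, a, b|rewrite e1 e3].
case=> /edgeP[k [a [b [h e1 e2 e3]]]] /eqP e4; exists k; apply/existsP; exists a.
by apply/existsP; exists b; apply/and5P; split; rewrite // ?e4 ?e1 ?e2 ?e3.
Qed.

(** An invariant of components that separates terminal vertices, each being its own right end. The
    fuel [m] is the number of columns still to the right. *)
Fixpoint right_end_rec (m i s : nat) : nat * nat :=
  if m is m'.+1 then
    if target n r edge i s < width n r i then right_end_rec m' i.+1 (target n r edge i s)
    else (i, s)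
  else (i, s).

Definition right_end (i s : nat) : nat * nat := right_end_rec (n - i) i s.

Lemma right_end_edge i s t : edge i s t -> right_end i s = right_end i.+1 t.
Proof.
move=> ed; have [hi _ _] := edge_dom ed.
rewrite /right_end -subnSK //= (edge_target edge_dom edge_fun ed).
by rewrite (edgeW edge_dom ed).
Qed.

Lemma right_end_terminal i s : terminal n r edge i s -> right_end i s = (i, s).
Proof. by move=> /eqP e; rewrite /right_end; case: (n - i) => //= m; rewrite e ltnn. Qed.

Lemma right_end_ge i s : i <= (right_end i s).1.
Proof.
rewrite /right_end; move: (n - i) => m; elim: m i s => //= m IH i s; case: ifP => // _.
exact: leq_trans (IH i.+1 _).
Qed.

Definition linked : rel (vertex n r) :=
  connect (fun x y => lacing_edge W x y || lacing_edge W y x).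

Lemma linked_invariant (T : Type) (f : nat -> nat -> T) :
    (forall i s t, edge i s t -> f i s = f i.+1 t) ->
  forall x y, linked x y -> f (tag x) (tagged x) = f (tag y) (tagged y).
Proof.
move=> fE x y /connectP[p]; elim: p x => [x _ ->//|z p IH x /= /andP[h pz] yE].
have fE' i j s t : edge i s t -> j = i.+1 -> f i s = f j t.
  by move=> ed ->; exact: fE.
rewrite -(IH z pz yE); case/orP: h; rewrite lacing_edgeE => /andP[ed /eqP e].
  exact: fE' ed e.
by rewrite (fE' _ _ _ _ ed e).
Qed.

Lemma linked_left_end (x : vertex n r) :
  exists2 y, linked x y & tag y = left_end r edge (tag x) (tagged x) :> nat.
Proof.
case: x => -[k hk] /= t; elim: k hk t => [|i IH] hk t.
  by exists (existT _ (Ordinal hk) t : vertex n r); rewrite ?/linked ?connect0.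
rewrite /=; case: ifP => hs; last first.
  by exists (existT _ (Ordinal hk) t : vertex n r); rewrite ?/linked ?connect0.
have ed := source_edge hs.
have hk' : i < n.+1 := ltnW hk.
have [y l e] := IH hk' (Ordinal hs); exists y => //.
apply: connect_trans l; apply: connect1; apply/orP; right.
by rewrite lacing_edgeE /= ed eqxx.
Qed.

Definition component (x : vertex n r) : {set vertex n r} :=
  [set y in [set: vertex n r] | linked x y].

Definition lace_ends (k i : nat) : {set 'I_(r i i)} :=
  [set s : 'I_(r i i) | terminal n r edge i s && (left_end r edge i s == k)].

(** A terminal vertex is sent to its component; [right_end] makes this injective, and the two end
    invariants keep the component between columns [k] and [i]. *)
Lemma card_lace_ends k i : i <= n -> #|lace_ends k i| <= #|laces W k i|.
Proof.
move=> hi; pose v (s : 'I_(r i i)) : vertex n r :=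
  existT (fun k : 'I_n.+1 => 'I_(r k k)) (Ordinal (hi : i < n.+1)) s.
have ends_inj : {in lace_ends k i &, injective (fun s => component (v s))}.
  move=> s s'; rewrite !inE => /andP[ts _] /andP[ts' _] e.
  have : v s' \in component (v s) by rewrite e !inE /= /linked connect0.
  rewrite !inE /= => /(linked_invariant right_end_edge) /=.
  by rewrite !right_end_terminal // => -[/val_inj].
rewrite -(card_in_imset ends_inj); apply: subset_leq_card; apply/subsetP => _ /imsetP[s + ->].
rewrite inE => /andP[ts /eqP le]; rewrite inE; apply/and4P; split.
- by apply: imset_f; rewrite inE.
- have [y l e] := linked_left_end (v s); apply/existsP; exists y.
  by rewrite !inE l e /= le eqxx.
- by apply/existsP; exists (v s); rewrite !inE /= /linked connect0 eqxx.
apply/forall_inP => y; rewrite !inE /= => l; apply/andP; split.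
  rewrite -le; have inv i' s' t' (ed : edge i' s' t') :=
    esym (left_end_edge edge_dom edge_inj ed).
  by rewrite (linked_invariant inv l) left_end_le.
have := linked_invariant right_end_edge l; rewrite /= right_end_terminal // => e.
by have := right_end_ge (tag y) (tagged y); rewrite -e.
Qed.

End Laces.

(** * Length of the minimal length embedding *)

Lemma mem_zip_nth (T U : eqType) (x0 : T) (y0 : U) (s : seq T) (t : seq U) p :
  p \in zip s t -> exists i, [/\ i < size s, i < size t, p.1 = nth x0 s i & p.2 = nth y0 t i].
Proof.
elim: s t => [|x s IH] [|y t] //=; rewrite inE => /orP[/eqP -> /=|/IH[i [h1 h2 -> ->]]].
  by exists 0.
by exists i.+1.
Qed.

Section Embedding.

Variables (a b : nat) (rho : 'M[bool]_(a, b)).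
Hypothesis rho_pp : partial_perm rho.

Let w := embedding rho.
Let fr := free_rows (mx_points rho) (iota 0 a).
Let top := mx_points rho ++ zip fr (iota b a).
Let fc := free_cols top (iota 0 (a + b)).

Lemma mx_pointsP p : reflect (exists i j, [/\ rho i j, p.1 = val i & p.2 = val j])
  (p \in mx_points rho).
Proof.
apply: (iffP mapP) => [[[i j]]|[i [j [h e1 e2]]]].
  by rewrite mem_filter => /andP[h _] ->; exists i, j.
by exists (i, j); [rewrite mem_filter h mem_enum|case: p e1 e2 => ? ? /= -> ->].
Qed.

Let graph_mem (p : 'I_(a + b)) : (val p, val (w p)) \in embedding_points rho.
Proof. by rewrite -(perm_mem (embeddingP rho_pp)); apply: image_f. Qed.

Let mem_graph (p q : nat) : (p, q) \in embedding_points rho ->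
  exists2 i : 'I_(a + b), p = i & q = w i.
Proof. by rewrite -(perm_mem (embeddingP rho_pp)) => /imageP[i _ [-> ->]]; exists i. Qed.

Let fr_lt x : x < size fr -> nth 0 fr x < a.
Proof. by move/(mem_nth 0); rewrite mem_filter mem_iota => /andP[_]. Qed.

Let fr_size : size fr <= a.
Proof. by rewrite -[leqRHS](size_iota 0) size_filter count_size. Qed.

Let graph_cases (p : 'I_(a + b)) :
  [\/ exists i j, [/\ rho i j, val p = val i & val (w p) = val j],
      exists x, [/\ x < size fr, val p = nth 0 fr x & val (w p) = b + x] |
      exists x, [/\ x < b, x < size fc, val p = a + x & val (w p) = nth 0 fc x]].
Proof.
have := graph_mem p; rewrite /embedding_points -/fr -/top -/fc mem_cat.
case/orP; first rewrite mem_cat => /orP[/mx_pointsP[i [j h]]|].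
- by constructor 1; exists i, j.
- move=> /(mem_zip_nth 0 0)[x [h1 h2 /= -> ->]]; constructor 2; exists x.
  by rewrite size_iota in h2; rewrite nth_iota.
- move=> /(mem_zip_nth 0 0)[x [h1 h2 /= -> ->]]; constructor 3; exists x.
  by rewrite size_iota in h1; rewrite nth_iota.
Qed.

Lemma embedding_edge (p : 'I_(a + b)) (i : 'I_a) (j : 'I_b) :
  rho i j -> p = i :> nat -> w p = j :> nat.
Proof.
move=> h pi; have : (val i, val j) \in embedding_points rho.
  by rewrite /embedding_points !mem_cat; apply/orP; left; apply/orP; left;
     apply/mx_pointsP; exists i, j.
by case/mem_graph => p' e1 ->; congr (val (w _)); apply: val_inj; rewrite /= pi.
Qed.

Lemma embedding_small (p : 'I_(a + b)) : p < a -> w p < b ->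
  exists i j, [/\ rho i j, p = i :> nat & w p = j :> nat].
Proof.
move=> pa wb; case: (graph_cases p) => [[i [j h]]|[x [_ _ e]]|[x [_ _ e _]]].
- by exists i, j.
- by rewrite /= in e; lia.
- by rewrite /= in e; lia.
Qed.

(** The added points run from northwest to southeast. Hence an inversion has its upper point in the
    first [a] rows and its lower point in the first [b] columns. *)
Lemma embedding_free_lt (p p' : 'I_(a + b)) : p < p' ->
  a <= p \/ b <= w p' -> a <= p \/ b <= w p -> w p < w p'.
Proof.
have fr_sorted : sorted ltn fr.
  by rewrite /fr /free_rows; apply: (sorted_filter ltn_trans); exact: iota_ltn_sorted.
have fc_sorted : sorted ltn fc.
  by rewrite /fc /free_cols; apply: (sorted_filter ltn_trans); exact: iota_ltn_sorted.
have mono s x y : sorted ltn s -> y < size s -> nth 0 s x < nth 0 s y -> x < size s -> x < y.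
  move=> ss ys lt xs; case: (ltngtP x y) => // [yx|e]; last by rewrite e ltnn in lt.
  by have := sorted_ltn_nth ltn_trans 0 ss y x ys xs yx; rewrite /=; lia.
(* The columns from [b] to [b + size fr - 1] are already taken, so a free column that is at least
   [b] lies beyond them. *)
have nofc x y : x < size fr -> y < size fc -> b <= nth 0 fc y -> b + x < nth 0 fc y.
  move=> xs /(mem_nth 0); set c := nth 0 fc y; rewrite mem_filter => /andP[ne _] bc.
  rewrite ltnNge; apply/negP => le; case/negP: ne.
  rewrite /unzip2 map_cat mem_cat -!/(unzip2 _) unzip2_zip_take take_iota.
  by apply/orP; right; rewrite mem_iota; lia.
move=> lt h1 h2.
case: (graph_cases p) => [[i [j [_ e1 e2]]]|[x [s1 e1 e2]]|[x [s1 s1' e1 e2]]].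
- by have := ltn_ord i; have := ltn_ord j; rewrite /= in e1 e2; lia.
- case: (graph_cases p') => [[i [j [_ e3 e4]]]|[y [s2 e3 e4]]|[y [s2 s2' e3 e4]]].
  + by have := ltn_ord j; have := fr_lt s1; rewrite /= in e1 e2 e3 e4; lia.
  + rewrite /= in e1 e2 e3 e4; rewrite e2 e4 ltn_add2l.
    by apply: (mono fr) => //; rewrite -e1 -e3.
  + rewrite /= in e1 e2 e3 e4; rewrite e2 e4; apply: nofc => //.
    by have := fr_lt s1; rewrite -e4; lia.
- case: (graph_cases p') => [[i [j [_ e3 e4]]]|[y [s2 e3 e4]]|[y [s2 s2' e3 e4]]].
  + by have := ltn_ord i; rewrite /= in e1 e2 e3 e4; lia.
  + by have := fr_lt s2; rewrite /= in e1 e2 e3 e4; lia.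
  + rewrite /= in e1 e2 e3 e4; rewrite e2 e4.
    by apply: (sorted_ltn_nth ltn_trans 0 fc_sorted) => //; lia.
Qed.

End Embedding.

(** Added rows start no inversion, by [embedding_free_lt]. For the other rows, taking the column of
    the lower point matches the inversions with the remaining vertices before the target. *)
Lemma sum_code n r (W : lacing n r) (k : 'I_n) : (forall k, partial_perm (W k)) ->
  \sum_(s < r k k) code n r (edge W) k s = inversions (embedding (W k)).
Proof.
move=> W_pp; set w := embedding (W k).
have Dom := @edge_dom _ _ W; have Fun := edge_fun W_pp; have Inj := edge_inj W_pp.
have wk : width n r k = r k.+1 k.+1 by rewrite /width ltn_ord.
have edge_w (p : 'I_(r k k + r k.+1 k.+1)) t : edge W k p t -> w p = t :> nat.
  move=> ed; have [_ h1 h2] := Dom _ _ _ ed.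
  apply: (@embedding_edge _ _ _ (W_pp k) p (Ordinal h1) (Ordinal h2)) => //.
  by rewrite -edge_ord.
have small_w (p : 'I_(r k k + r k.+1 k.+1)) : p < r k k -> w p < r k.+1 k.+1 -> edge W k p (w p).
  move=> h1 h2; have [i [j [h -> ->]]] := embedding_small (W_pp k) h1 h2.
  by rewrite edge_ord.
have target_w (p : 'I_(r k k + r k.+1 k.+1)) : p < r k k -> target n r (edge W) k p <= w p.
  move=> hp; case: (ltnP (w p) (r k.+1 k.+1)) => h.
    by rewrite (edge_target Dom Fun (small_w _ hp h)).
  by have := target_le n r (edge W) k p; lia.
have codeE (p : 'I_(r k k + r k.+1 k.+1)) : p < r k k ->
    #|[set p' : 'I_(r k k + r k.+1 k.+1) | (p < p') && (w p' < w p)]| = code n r (edge W) k p.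
  move=> hp; rewrite /code /rank_remaining -size_filter -sum1_card.
  set L := filter _ _.
  have uL : uniq L by rewrite filter_uniq // iota_uniq.
  rewrite sum1_card cardE -(size_map (fun p' => val (w p'))).
  apply: perm_size; apply: uniq_perm => //.
    by rewrite map_inj_uniq ?enum_uniq // => x y /val_inj /perm_inj.
  move=> t; apply/mapP/idP => [[p']|].
    rewrite mem_enum inE => /andP[h1 h2] ->.
    rewrite mem_filter mem_iota add0n; apply/andP; split.
      apply/hasPn => s; rewrite mem_iota => hs; apply/negP => ed.
      have [_ h3 _] := Dom _ _ _ ed.
      have := edge_w (Ordinal (ltn_addr (r k.+1 k.+1) h3)) _ ed => /val_inj /perm_inj e.
      by move: hs h1; rewrite -e /=; lia.
    case: (ltnP (w p) (r k.+1 k.+1)) => h.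
      by rewrite (edge_target Dom Fun (small_w _ hp h)).
    rewrite /= leqNgt; apply/negP => h3.
    have := embedding_free_lt (W_pp k) h1 _ (or_intror h); rewrite -/w.
    have h4 : r k.+1 k.+1 <= w p'.
      rewrite leqNgt; apply/negP => h4; have := target_le n r (edge W) k p.
      have h5 : target n r (edge W) k p < width n r k by rewrite wk; lia.
      by have := edge_w _ _ (target_edge h5); lia.
    by move=> /(_ (or_intror h4)); lia.
  rewrite mem_filter mem_iota add0n => /andP[rem /andP[_ lt]].
  have tb : t < r k.+1 k.+1 by have := target_le n r (edge W) k p; lia.
  pose t' : 'I_(r k k + r k.+1 k.+1) := Ordinal (ltn_addl (r k k) tb).
  exists (w^-1 t')%g; last by rewrite permKV.
  have wt : w (w^-1 t')%g = t :> nat by rewrite permKV.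
  rewrite mem_enum inE wt (leq_trans lt (target_w _ hp)) andbT.
  rewrite ltnNge; apply/negP; rewrite leq_eqVlt => /orP[/eqP e|h].
    have := target_w p hp; rewrite -(val_inj e) wt => h.
    by rewrite -(val_inj e) in lt; lia.
  case/negP: rem; apply/hasP; exists (val (w^-1 t')%g); first by rewrite mem_iota.
  rewrite -[X in edge _ _ _ X]wt; apply: small_w; last by rewrite wt.
  exact: ltn_trans h hp.
rewrite /inversions -sum1_card.
rewrite (partition_big fst predT) //=.
rewrite big_split_ord /= [X in _ = _ + X]big1 ?addn0; last first.
  move=> i _; rewrite big_pred0 // => -[p p']; rewrite inE /=.
  apply/negP => /andP[/andP[h1 h2] /eqP e]; subst p.
  have := embedding_free_lt (W_pp k) h1; rewrite -/w /=.
  by move=> /(_ (or_introl (leq_addr _ _)) (or_introl (leq_addr _ _))); lia.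
apply: eq_bigr => s _; transitivity (code n r (edge W) k (lshift (r k.+1 k.+1) s)) => //.
rewrite -codeE //= -sum1_card.
rewrite (reindex_onto (fun p' => (lshift (r k.+1 k.+1) s, p')) snd) /=; last first.
  by move=> [p p'] /= /andP[_ /eqP ->].
by apply: eq_bigl => p'; rewrite !inE !eqxx !andbT.
Qed.

(** * Block counts and the codimension formula *)

Lemma sum_fibers (T : finType) (P : pred T) (F : T -> nat) (f : T -> nat) N :
    (forall x, P x -> f x < N) ->
  \sum_(x | P x) F x = \sum_(k < N) \sum_(x | P x && (f x == k)) F x.
Proof.
case: N => [|N] fN.
  by rewrite big_ord0 big_pred0 // => x; apply/negP => /fN.
rewrite (partition_big (fun x => inord (f x) : 'I_N.+1) predT) //=.
apply: eq_bigr => k _; apply: eq_bigl => x.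
case: (boolP (P x)) => //= /fN lt.
by rewrite -val_eqE /= inordK.
Qed.

Lemma card_sum_fibers (T : finType) (A : {set T}) (f : T -> nat) N :
  (forall x, x \in A -> f x < N) -> #|A| = \sum_(k < N) #|[set x in A | f x == k]|.
Proof.
move=> fN; rewrite -sum1_card (sum_fibers _ fN); apply: eq_bigr => k _.
by rewrite -sum1_card; apply: eq_bigl => x; rewrite inE.
Qed.

Lemma card_ord_interval d a b : b <= d -> #|[set p : 'I_d | a <= p < b]| = b - a.
Proof.
move=> bd; rewrite -(size_iota a (b - a)) cardE -(size_map val).
apply: perm_size; apply: uniq_perm; rewrite ?iota_uniq ?(map_inj_uniq val_inj) ?enum_uniq //.
move=> x; rewrite mem_iota; apply/mapP/idP => [[p]|h].
  by rewrite mem_enum inE => h ->; rewrite /=; lia.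
have xd : x < d by lia.
by exists (Ordinal xd); rewrite // mem_enum inE /=; lia.
Qed.

Lemma sum_vertex_rows n r (F : nat -> nat) :
  \sum_(p < total_dim n r) F p = \sum_(i < n.+1) \sum_(s < r i i) F (vertex_row r i s).
Proof.
rewrite -[total_dim n r]/(block_row r n.+1); elim: n.+1 => [|m IH].
  by rewrite big_ord0 /block_row big_ord0 big_ord0.
rewrite big_ord_recr /= -IH block_rowS big_split_ord /=; congr (_ + _).
rewrite (reindex_inj rev_ord_inj) /=; apply: eq_bigr => s _; congr F.
by rewrite /vertex_row block_rowS; have := ltn_ord s; lia.
Qed.

(** Both sides are the sum of [r i i * r k k] over [i < k]; this is extracted from two expansions of
    the square of the total dimension. *)
Lemma sum_diag_block_row n (r : nat -> nat -> nat) :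
  \sum_(i < n.+1) r i i * first_col n r i = \sum_(i < n.+1) r i i * block_row r i.
Proof.
have sq m : block_row r m * block_row r m =
    \sum_(i < m) (r i i * block_row r i + (r i i * block_row r i + r i i * r i i)).
  elim: m => [|m IH]; first by rewrite /block_row !big_ord0.
  by rewrite big_ord_recr /= -IH block_rowS; nia.
have e : \sum_(i < n.+1) r i i * first_col n r i +
    \sum_(i < n.+1) (r i i * block_row r i + r i i * r i i) =
    block_row r n.+1 * block_row r n.+1.
  rewrite -big_split {3}/block_row /= big_distrl /=; apply: eq_bigr => i _.
  rewrite -!mulnDr; congr (_ * _).
  have hi : i <= n by rewrite -ltnS.
  by have := block_row_first_col r hi; rewrite block_rowS /total_dim -/(block_row r n.+1); lia.
by move: e; rewrite sq !big_split /=; lia.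
Qed.

Section LaceIdentity.

Variables (n : nat) (r : nat -> nat -> nat).
Hypothesis occ : occur n r.

(* The number of points of the Zelevinsky permutation in the block M_(i, n-k). *)
Definition block_count (i k : nat) : nat :=
  if k <= i then block_points n r i (n - k) else if k == i.+1 then r i k else 0.

Lemma block_count_lace i k : k <= i <= n -> Posz (block_count i k) = lace_array n r k i.
Proof.
move=> h; rewrite /block_count /block_points ifT; last by lia.
rewrite subKn; last by lia.
by rewrite ifT ?gez0_abs //; [apply: (proj2 occ); lia|lia].
Qed.

Lemma sum_block_count_row i : i <= n -> \sum_(k < n.+1) block_count i k = r i i.
Proof.
move=> hi; rewrite -[RHS](sum_row_points occ hi) [X in _ = X + _](reindex_inj rev_ord_inj) /=.
have -> : (if i < n then r i i.+1 else 0) = \sum_(k < n.+1) (if k == i.+1 :> nat then r i k else 0).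
  rewrite -big_mkcond /=; case: ltnP => lt; last first.
    rewrite big_pred0 // => k; apply/eqP; have := ltn_ord k; lia.
  rewrite (big_pred1 (Ordinal (lt : i.+1 < n.+1))) //.
rewrite -big_split /=; apply: eq_bigr => k _; rewrite /block_count subSS.
have hk := ltn_ord k.
case: leqP => h; first by rewrite ifF ?addn0 //; lia.
rewrite (_ : block_points n r i (n - k) = 0) ?add0n // /block_points subKn ?ifF //; lia.
Qed.

Lemma sum_block_count_col k : k <= n -> \sum_(i < n.+1) block_count i k = r k k.
Proof.
move=> hk; have := sum_col_points occ (leq_subr k n); rewrite subKn // => <-.
have -> : (if n - k < n then r k.-1 k else 0) = \sum_(i < n.+1) (if k == i.+1 then r i k else 0).
  rewrite -big_mkcond /=; case: k hk => [|k] hk.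
    by rewrite subn0 ltnn big_pred0.
  rewrite ifT; last by lia.
  by rewrite (big_pred1 (Ordinal (ltnW hk : k < n.+1))) // => i; rewrite eqSS eq_sym.
rewrite -big_split /=; apply: eq_bigr => i _; rewrite /block_count.
case: leqP => h; first by rewrite ifF ?addn0 //; lia.
rewrite (_ : block_points n r i (n - k) = 0) ?add0n // /block_points subKn ?ifF //; lia.
Qed.

Lemma sum_lace_array i K : (\sum_(0 <= k < K.+1) lace_array n r k i =
    rank n r K i - rank n r K (i%:Z + 1))%R.
Proof.
elim: K => [|K IH]; first by rewrite big_nat1 /lace_array /= subr0 addr0.
rewrite big_nat_recr // IH /lace_array.
have -> : (K.+1%:Z - 1 = K%:Z)%R by lia.
move: (rank n r K) (rank n r K.+1) => f g /=; lia.
Qed.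

(** Summing the lace array over [k'] and telescoping over [i'] recovers the ranks. West means
    smaller labels [k], which lie further right in the grid. *)
Lemma sum_block_count_southwest i k : k <= i <= n ->
  \sum_(i <= i' < n.+1) \sum_(k' < k.+1) block_count i' k' = r k i.
Proof.
move=> /andP[ki hi]; apply/eqP; rewrite -eqz_nat Posz_sum; apply/eqP.
have -> : (\sum_(i <= i' < n.+1) Posz (\sum_(k' < k.+1) block_count i' k') =
    \sum_(i <= i' < n.+1) - (rank n r k i'.+1 - rank n r k i'))%R.
  apply: eq_big_nat => i' hi'; rewrite Posz_sum.
  have -> : (\sum_(k' < k.+1) Posz (block_count i' k') =
     \sum_(0 <= k' < k.+1) lace_array n r k' i')%R.
    by rewrite big_mkord; apply: eq_bigr => k' _; apply: block_count_lace; have := ltn_ord k'; lia.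
  rewrite sum_lace_array; have -> : (i'%:Z + 1 = i'.+1%:Z)%R by lia.
  by rewrite opprB.
rewrite sumrN telescope_sumr; last by lia.
rewrite /rank ltnn andbF hi ifT; lia.
Qed.

Lemma codim_telescope a : a < n ->
  (\sum_(a.+1 <= b < n.+1) Posz (block_count b a.+1 * r a b) + Posz (r a a.+1 * r a a)
   + \sum_(a.+1 <= b < n.+1) ((r a b.-1)%:Z - (r a b)%:Z) * ((r a.+1 b)%:Z - (r a b)%:Z)
   = Posz (r a a * r a.+1 a.+1))%R.
Proof.
move=> an.
pose R x b := if b <= n then Posz (r x b) else 0%R.
(* A discrete antiderivative: with the lace array in place of the block count, the remaining
   products are [T b.+1 - T b]. As [R] is 0 beyond [n], only the lower boundary term survives. *)
pose T b := (R a b * R a b.-1 - R a b.-1 * R a.+1 b)%R.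
rewrite addrAC -big_split /=.
have -> : (\sum_(a.+1 <= b < n.+1) (Posz (block_count b a.+1 * r a b) +
    ((r a b.-1)%:Z - (r a b)%:Z) * ((r a.+1 b)%:Z - (r a b)%:Z)) =
    \sum_(a.+1 <= b < n.+1) (T b.+1 - T b))%R.
  apply: eq_big_nat => b hb; rewrite PoszM block_count_lace; last by lia.
  have -> : lace_array n r a.+1 b = (R a.+1 b - R a b - R a.+1 b.+1 + R a b.+1)%R.
    rewrite /lace_array; have -> : (a.+1%:Z - 1 = a%:Z)%R by lia.
    have -> : (b%:Z + 1 = b.+1%:Z)%R by lia.
    by rewrite /rank /R (ltnW an) an.
  have e1 : Posz (r a b) = R a b by rewrite /R ifT //; lia.
  have e2 : Posz (r a.+1 b) = R a.+1 b by rewrite /R ifT //; lia.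
  have e3 : Posz (r a b.-1) = R a b.-1 by rewrite /R ifT //; lia.
  rewrite e1 e2 e3 /T /=; lia.
rewrite telescope_sumr; last by lia.
rewrite /T /= /R ltnn an (ltnW an); lia.
Qed.

End LaceIdentity.

(** * Exit counts, crosses and block inversions *)

Section BlockCounts.

Variables (n : nat) (r : nat -> nat -> nat) (W : lacing n r).
Hypothesis occ : occur n r.
Hypothesis W_pp : forall k, partial_perm (W k).
Hypothesis W_laces : forall i j : 'I_n.+1, i <= j -> Posz #|laces W i j| = lace_array n r i j.

Notation d := (total_dim n r).
Notation C := (cross n r (edge W)).
Notation row_block := (row_block n r).
Notation col_block := (col_block n r).
Notation first_col := (first_col n r).
Notation block_count := (block_count n r).

Variable u : 'S_d.
Hypothesis uE : forall p, u p = column_at d C 0 p :> nat.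

Let Dom := @edge_dom _ _ W.
Let Fun := edge_fun W_pp.
Let Inj := edge_inj W_pp.

Definition exit_count (i k : nat) : nat :=
  #|[set p : 'I_d | (row_block p == i) && (col_block (u p) == k)]|.

Let row_le (p : 'I_d) : row_block p <= n.
Proof. by have [] := row_blockP (ltn_ord p). Qed.

Let col_le (p : 'I_d) : col_block p <= n.
Proof. by have [] := col_blockP (ltn_ord p). Qed.

Let row_vertex (p : 'I_d) : exists2 s, s < r (row_block p) (row_block p) &
  p = vertex_row r (row_block p) s :> nat.
Proof.
have [_ h] := row_blockP (ltn_ord p).
exists (block_row r (row_block p).+1 - p.+1); rewrite /vertex_row;
by have := block_rowS r (row_block p); lia.
Qed.

Let exit_le (p : 'I_d) : col_block (u p) <= (row_block p).+1.
Proof.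
have [s hs e] := row_vertex p; rewrite uE [in column_at _ _ _ _]e.
case: (exit_block Dom Fun Inj (row_le p) hs) => [[-> _]//|[s' [_ _ _ ->]]].
exact: leq_trans (left_end_le _ _ _ _) _.
Qed.

Let exit_count0 i k : i.+1 < k -> exit_count i k = 0.
Proof.
move=> h; apply/eqP; rewrite cards_eq0; apply/eqP/setP => p; rewrite !inE.
by apply/negP => /andP[/eqP e1 /eqP e2]; have := exit_le p; lia.
Qed.

(** Such a pipe meets the line above block row [i] at a terminal vertex with left end [k], and
    distinct pipes meet it in distinct columns. *)
Let exit_count_le i k : k <= i <= n -> exit_count i k <= block_count i k.
Proof.
move=> /andP[ki hi].
have -> : block_count i k = #|laces W k i|.
  apply/eqP; rewrite -eqz_nat block_count_lace //; last by rewrite ki.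
  have hk : k < n.+1 by lia.
  by have /= <- := @W_laces (Ordinal hk) (Ordinal (hi : i < n.+1)) ki.
apply: leq_trans (card_lace_ends W_pp k hi).
pose f (p : 'I_d) := [pick s : 'I_(r i i) |
  column_at d C (block_row r i) (p - block_row r i) == vertex_col n r i s].
have fP (p : 'I_d) : row_block p = i -> col_block (u p) = k -> exists s : 'I_(r i i),
    [/\ f p = Some s, s \in lace_ends W k i &
        column_at d C (block_row r i) (p - block_row r i) = vertex_col n r i s].
  move=> e1 e2; have [s hs e] := row_vertex p; rewrite e1 in hs e.
  have := exit_block Dom Fun Inj hi hs; rewrite -e -uE e2.
  case=> [[e3 _]|[s' [h1 h2 h3 h4]]]; first by lia.
  have es : p - block_row r i = r i i - s.+1.
    by rewrite e /vertex_row; have := block_rowS r i; lia.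
  exists (Ordinal h1); rewrite /f es h3 inE h2 /= h4 eqxx; split=> //.
  case: pickP => [s1 /eqP e4|/(_ (Ordinal h1))]; last by rewrite eqxx.
  by congr Some; apply: val_inj; have := ltn_ord s1; move: e4; rewrite /vertex_col /=; lia.
rewrite /exit_count -(card_in_imset (f := f)); last first.
  move=> p p'; rewrite !inE => /andP[/eqP e1 /eqP e2] /andP[/eqP e1' /eqP e2'] e.
  have [s [h1 _ h3]] := fP p e1 e2; have [s' [h1' _ h3']] := fP p' e1' e2'.
  move: h1; rewrite e h1' => -[es]; subst s'; rewrite -h3 in h3'.
  have [_ h4] := row_blockP (ltn_ord p); have [_ h4'] := row_blockP (ltn_ord p').
  rewrite e1 in h4; rewrite e1' in h4'.
  apply: val_inj => /=; have := ltn_ord p; have := ltn_ord p' => hp' hp.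
  have := column_at_inj (cross_triangular (n := n) (r := r) (edge := edge W)) _ _ h3'.
  by move=> /(_ _ _); lia.
have some_inj : injective (@Some 'I_(r i i)) by move=> x y [].
rewrite -(card_imset _ some_inj).
apply: subset_leq_card; apply/subsetP => x /imsetP[p].
rewrite inE => /andP[/eqP e1 /eqP e2] ->.
by have [s [-> h _]] := fP p e1 e2; apply: imset_f.
Qed.

Lemma card_row_block i : i <= n -> #|[set p : 'I_d | row_block p == i]| = r i i.
Proof.
move=> hi; have h := block_row_first_col r hi; have h' := block_rowS r i.
have -> : r i i = block_row r i.+1 - block_row r i by lia.
rewrite -(@card_ord_interval d); last by lia.
apply: eq_card => p; rewrite !inE; apply/eqP/idP => [<-|]; last exact: row_block_eq.
by have [] := row_blockP (ltn_ord p).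
Qed.

Lemma card_col_block k : k <= n -> #|[set p : 'I_d | col_block (u p) == k]| = r k k.
Proof.
move=> hk; have h := first_col_end r hk.
have -> : r k k = first_col k + r k k - first_col k by lia.
rewrite -(@card_ord_interval d) // -[RHS](card_preimset _ (@perm_inj _ u)).
apply: eq_card => p; rewrite !inE; apply/eqP/idP => [<-|]; last exact: col_block_eq.
by have [] := col_blockP (ltn_ord (u p)).
Qed.

Lemma sum_exit_count_row i : i <= n -> \sum_(k < n.+1) exit_count i k = r i i.
Proof.
move=> hi; rewrite -(card_row_block hi).
rewrite (card_sum_fibers (f := fun p => col_block (u p)) (N := n.+1)).
  by apply: eq_bigr => k _; apply: eq_card => p; rewrite !inE.
by move=> p _; rewrite ltnS.
Qed.

Lemma sum_exit_count_col k : k <= n -> \sum_(i < n.+1) exit_count i k = r k k.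
Proof.
move=> hk; rewrite -(card_col_block hk).
rewrite (card_sum_fibers (f := fun p : 'I_d => row_block p) (N := n.+1)).
  by apply: eq_bigr => i _; apply: eq_card => p; rewrite !inE andbC.
by move=> p _; rewrite ltnS.
Qed.

(* Below the superantidiagonal blocks the count is bounded by the number of
   laces. Going up through the block rows, the column sums determine the
   superantidiagonal block, and then the row sum forces equality. *)
Lemma exit_countE i k : i <= n -> k <= n -> exit_count i k = block_count i k.
Proof.
suff main m : forall i k, i <= n -> n < i + m -> k <= n -> exit_count i k = block_count i k.
  by move=> hi hk; apply: (main n.+1); lia.
elim: m => {i k} [|m IH] i k hi; first by lia.
move=> him.
have count0 i' k' : i'.+1 < k' -> block_count i' k' = 0.
  by move=> h; rewrite /block_count !ifF //; lia.
have diag : i < n -> exit_count i i.+1 = block_count i i.+1.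
  move=> lt; have := sum_exit_count_col lt; rewrite -(sum_block_count_col occ lt).
  rewrite (bigD1 (Ordinal (hi : i < n.+1))) // [RHS](bigD1 (Ordinal (hi : i < n.+1))) //=.
  move=> e; apply/eqP; move/eqP: e; rewrite (eq_bigr (fun i' : 'I_n.+1 => block_count i' i.+1)).
    by rewrite eqn_add2r.
  move=> i'; rewrite -val_eqE /= => ne; have := ltn_ord i' => hi'.
  case: (ltngtP i' i) => h; last by rewrite h eqxx in ne.
    by rewrite exit_count0 ?count0.
  by apply: IH => //; lia.
move=> hk; have := sum_exit_count_row hi; rewrite -(sum_block_count_row occ hi).
have le (k' : 'I_n.+1) : true -> exit_count i k' <= block_count i k' ?= iff
    (exit_count i k' == block_count i k').
  move=> _; apply: leqif_eq; have := ltn_ord k' => hk'.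
  case: (ltngtP k' i.+1) => h; first by apply: exit_count_le; lia.
    by rewrite exit_count0.
  by rewrite h diag //; lia.
move/eqP; rewrite (leqif_sum le) => /forallP /(_ (Ordinal (hk : k < n.+1))) /=.
by move/eqP.
Qed.

Definition crosses : {set 'I_d * 'I_d} := [set b : 'I_d * 'I_d | C b.1 b.2].

Lemma card_crosses : Posz #|crosses| =
  (Posz (\sum_(i < n.+1) r i i * first_col i.+1) + Posz (lacing_length W))%R.
Proof.
rewrite -PoszD; congr Posz.
have -> : #|crosses| = \sum_(p < d) #|[set q : 'I_d | C p q]|.
  rewrite -sum1_card (partition_big fst predT) //=; apply: eq_bigr => p _.
  rewrite -sum1_card (reindex_onto (fun q => (p, q)) snd) /=; last first.
    by move=> [p' q] /= /andP[_ /eqP ->].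
  by apply: eq_bigl => q; rewrite !inE !eqxx !andbT.
rewrite (@sum_vertex_rows n r (fun p => #|[set q : 'I_d | C p q]|)).
have row i (s : 'I_(r i i)) : i <= n -> #|[set q : 'I_d | C (vertex_row r i s) q]| =
    first_col i.+1 + code n r (edge W) i s.
  move=> hi; have h := first_colE r hi; have hc := code_le n r (edge W) i s.
  have h' := first_col_end r hi.
  rewrite -(cardsID [set q : 'I_d | 0 <= q < first_col i.+1]).
  congr (_ + _).
    rewrite -[RHS]subn0 -(@card_ord_interval d); last by lia.
    by apply: eq_card => q; rewrite !inE crossE //; lia.
  transitivity (first_col i - (first_col i - code n r (edge W) i s)); last by lia.
  rewrite -(@card_ord_interval d); last by lia.
  by apply: eq_card => q; rewrite !inE crossE //; lia.
transitivity (\sum_(i < n.+1) (r i i * first_col i.+1 + \sum_(s < r i i) code n r (edge W) i s)).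
  apply: eq_bigr => i _.
  rewrite (eq_bigr (fun s : 'I_(r i i) => first_col i.+1 + code n r (edge W) i s)).
    by rewrite big_split /= sum_nat_const card_ord.
  by move=> s _; apply: row; rewrite -ltnS.
rewrite big_split /=; congr (_ + _); rewrite big_ord_recr /=.
rewrite [X in _ + X]big1 ?addn0; last first.
  move=> s _; apply/eqP; rewrite -leqn0; apply: leq_trans (code_le _ _ _ _ _) _.
  by rewrite /width ltnn.
by apply: eq_bigr => k _; exact: (sum_code (W := W) k W_pp).
Qed.

(** As labels decrease to the right, these are the inversions of [u] whose points differ in both
    block row and block column. *)
Definition block_inversions : {set 'I_d * 'I_d} :=
  [set x : 'I_d * 'I_d |
    (row_block x.1 < row_block x.2) && (col_block (u x.1) < col_block (u x.2))].

Lemma card_southwest_block i k : i <= n -> k <= n ->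
  #|[set p : 'I_d | (i <= row_block p) && (col_block (u p) < k)]| =
  \sum_(i <= i' < n.+1) \sum_(k' < k) block_count i' k'.
Proof.
move=> hi hk; rewrite (card_sum_fibers (f := fun p : 'I_d => row_block p) (N := n.+1)); last first.
  by move=> p _; rewrite ltnS.
rewrite -(big_mkord xpredT (fun i' =>
  #|[set p in [set p : 'I_d | (i <= row_block p) && (col_block (u p) < k)]
     | row_block p == i']|)).
rewrite (big_cat_nat (n := i)) //=; last by lia.
rewrite big_nat_cond big1 ?add0n; last first.
  move=> i' /andP[hi' _]; apply/eqP; rewrite cards_eq0; apply/eqP/setP => p.
  by rewrite !inE; lia.
apply: eq_big_nat => i' hi'.
rewrite (card_sum_fibers (f := fun p => col_block (u p)) (N := k)); last first.
  by move=> p; rewrite !inE => /andP[/andP[_ ->]].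
apply: eq_bigr => k' _; have := ltn_ord k' => hk'.
rewrite -exit_countE; [|lia|lia].
by apply: eq_card => p; rewrite !inE; lia.
Qed.

Lemma sum_exit_blocks (F : nat -> nat -> nat) :
  \sum_(p : 'I_d) F (row_block p) (col_block (u p)) =
  \sum_(i < n.+1) \sum_(k < n.+1) block_count i k * F i k.
Proof.
rewrite (@sum_fibers _ _ _ (fun p : 'I_d => row_block p) n.+1); last first.
  by move=> p _; rewrite ltnS.
apply: eq_bigr => i _.
rewrite (@sum_fibers _ _ _ (fun p => col_block (u p)) n.+1); last first.
  by move=> p _; rewrite ltnS.
apply: eq_bigr => k _; rewrite -exit_countE; [|by rewrite -ltnS|by rewrite -ltnS].
rewrite -sum_nat_const; apply: eq_big => p; first by rewrite inE.
by move=> /andP[/eqP -> /eqP ->].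
Qed.

Let southwest (i k : nat) : nat := if k is a.+1 then r a i else 0.

Let southwestE (p : 'I_d) :
  #|[set q : 'I_d | (row_block p <= row_block q) && (col_block (u q) < col_block (u p))]| =
  southwest (row_block p) (col_block (u p)).
Proof.
rewrite card_southwest_block; [|exact: row_le|exact: col_le].
have := exit_le p; case: (col_block (u p)) => [|k] h; last first.
  by rewrite (@sum_block_count_southwest n r occ) // row_le andbT.
by rewrite big1 // => i _; rewrite big_ord0.
Qed.

(** With its lower point [p] fixed, an inversion is a choice among all points of smaller label,
    [block_row] many, minus those not in an earlier block row, a rank by [southwestE]. The ranks are
    summed with [codim_telescope]. *)
Lemma card_block_inversions : Posz (lacing_length W) = expected_codim n r ->
  #|block_inversions| = #|crosses|.
Proof.
move=> len.
have fib : #|block_inversions| = \sum_(p < d)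
    #|[set q : 'I_d | (row_block q < row_block p) && (col_block (u q) < col_block (u p))]|.
  rewrite -sum1_card (partition_big snd predT) //=; apply: eq_bigr => p _.
  rewrite -sum1_card (reindex_onto (fun q => (q, p)) fst) /=; last first.
    by move=> [q p'] /= /andP[_ /eqP ->].
  by apply: eq_bigl => q; rewrite !inE !eqxx !andbT.
have west (p : 'I_d) : #|[set q : 'I_d | col_block (u q) < col_block (u p)]| =
    block_row r (col_block (u p)).
  rewrite (card_sum_fibers (f := fun q => col_block (u q)) (N := col_block (u p))); last first.
    by move=> q; rewrite inE.
  apply: eq_bigr => k _; rewrite -card_col_block; last first.
    by apply: leq_trans (col_le (u p)); apply: ltnW.
  by apply: eq_card => q; rewrite !inE; case: eqP => [->|]; rewrite ?andbF ?ltn_ord.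
have split : #|block_inversions| + \sum_(p : 'I_d) southwest (row_block p) (col_block (u p)) =
    \sum_(p : 'I_d) block_row r (col_block (u p)).
  rewrite fib -big_split /=; apply: eq_bigr => p _; rewrite -west -southwestE addnC.
  rewrite -[RHS](cardsID [set q : 'I_d | row_block p <= row_block q]).
  by congr (_ + _); apply: eq_card => q; rewrite !inE; lia.
have total : \sum_(p : 'I_d) block_row r (col_block (u p)) = \sum_(k < n.+1) r k k * block_row r k.
  rewrite (sum_exit_blocks (fun _ k => block_row r k)) exchange_big /=.
  apply: eq_bigr => k _; rewrite -big_distrl /= sum_block_count_col //.
  by rewrite -ltnS.
have sw : \sum_(p : 'I_d) southwest (row_block p) (col_block (u p)) = \sum_(a < n)
    (\sum_(a.+1 <= b < n.+1) block_count b a.+1 * r a b + r a a.+1 * r a a).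
  rewrite sum_exit_blocks exchange_big /= big_ord_recl /= big1 ?add0n; last first.
    by move=> i _; rewrite muln0.
  apply: eq_bigr => a _; rewrite /bump leq0n add1n.
  rewrite -(big_mkord xpredT (fun i => block_count i a.+1 * r a i)).
  have an := ltn_ord a.
  rewrite (big_cat_nat (n := a)) //=; last by lia.
  rewrite big_nat_cond big1 ?add0n; last first.
    by move=> i /andP[hi _]; rewrite /block_count !ifF //; lia.
  rewrite big_ltn; last by lia.
  by rewrite addnC; congr (_ + _ * _); rewrite /block_count ltnn eqxx.
have diag : \sum_(i < n.+1) r i i * first_col i.+1 + \sum_(a < n) r a a * r a.+1 a.+1 =
    \sum_(k < n.+1) r k k * block_row r k.
  rewrite -sum_diag_block_row [X in _ + X](_ : _ = \sum_(a < n.+1) r a a * width n r a).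
    rewrite -big_split /=; apply: eq_bigr => i _; rewrite -mulnDr -first_colE //.
    by rewrite -ltnS.
  rewrite big_ord_recr /= {2}/width ltnn muln0 addn0; apply: eq_bigr => a _.
  by rewrite /width ltn_ord.
have codim : expected_codim n r = (\sum_(a < n) \sum_(a.+1 <= b < n.+1)
    ((r a b.-1)%:Z - (r a b)%:Z) * ((r a.+1 b)%:Z - (r a b)%:Z))%R.
  rewrite /expected_codim big_ord_recr /= [X in (_ + X)%R]big_pred0 ?addr0; last first.
    by move=> j; have := ltn_ord j; lia.
  by apply: eq_bigr => a _; rewrite big_geq_mkord.
have : (Posz (\sum_(p : 'I_d) southwest (row_block p) (col_block (u p))) + expected_codim n r =
    Posz (\sum_(a < n) r a a * r a.+1 a.+1))%R.
  rewrite sw codim !Posz_sum -big_split /=; apply: eq_bigr => a _.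
  by rewrite -(codim_telescope occ) // PoszD Posz_sum.
have := card_crosses; rewrite len; lia.
Qed.

End BlockCounts.

(** * The Zelevinsky permutation *)

Lemma occupied_free N (h : nat -> nat) occ A i : occupied N h occ A -> i < N ->
  [seq x <- iota (\sum_(k < i) h k) (h i) | x \notin occ] =
  iota (\sum_(k < i) h k) (h i - A i).
Proof.
move=> [_ mem _] iN; set o := \sum_(k < i) h k.
have memo x : o <= x < o + h i -> (x \notin occ) = (x < o + (h i - A i)).
  by move=> hx; rewrite -{1}(subnKC (n := x) (m := o)) ?mem //; lia.
rewrite -[h i in LHS](@subnKC (h i - A i)) ?leq_subr // iotaD filter_cat.
rewrite [X in _ ++ X](_ : _ = [::]) ?cats0.
  by apply/all_filterP/allP => x; rewrite mem_iota => hx; rewrite memo; lia.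
apply/eqP; rewrite -size_eq0 size_filter -leqn0 leqNgt -has_count.
by apply/hasPn => x; rewrite mem_iota => hx; rewrite memo; lia.
Qed.

Lemma mem_zip_rev_iota a l b l' m x : x < m -> x < l -> x < l' ->
  (a + l - x.+1, b + l' - x.+1) \in zip (take m (rev (iota a l))) (take m (rev (iota b l'))).
Proof.
move=> xm xl xl'; set s := take m _; set t := take m _.
have xs : x < size s by rewrite size_take size_rev size_iota; case: ifP; lia.
have xt : x < size t by rewrite size_take size_rev size_iota; case: ifP; lia.
have xz : x < size (zip s t) by rewrite size_zip leq_min xs xt.
have := mem_nth (0, 0) xz; rewrite nth_zip_cond xz !nth_take // !nth_rev ?size_iota //.
rewrite !nth_iota; [|lia|lia].
by rewrite -!addnBA.
Qed.

Section ZelevinskyPoints.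

Variables (n : nat) (r : nat -> nat -> nat).
Hypothesis occ : occur n r.

(** When M_ij is filled, the blocks to its right have used the last rows and the blocks below it the
    last columns, as many as they have points; point [x] is counted backwards from there. *)
Lemma southeast_points_mem i j x : i <= n -> j <= n -> x < block_points n r i j ->
  (block_row r i + (r i i - \sum_(j.+1 <= j' < n.+1) block_points n r i j') - x.+1,
   block_col n r j + (r (n - j) (n - j) - \sum_(i.+1 <= i' < n.+1) block_points n r i' j) - x.+1)
  \in southeast_points n r.
Proof.
move=> hi hj hx.
have rev_split a : a <= n -> rev (iota 0 n.+1) = rev (iota a.+1 (n - a)) ++ a :: rev (iota 0 a).
  move=> ha; have -> : n.+1 = a + (n - a).+1 by lia.
  by rewrite iotaD rev_cat /= rev_cons cat_rcons add0n.
have mono pts (s : seq (nat * nat)) : {subset pts <= foldl (fill_block n r) pts s}.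
  elim: s pts => [|[i' j'] s IH] pts y hy //=; apply: IH.
  by rewrite /fill_block mem_cat hy.
have -> : southeast_points n r = foldl (fill_block n r) [::]
    [seq (i', j') | i' <- rev (iota i.+1 (n - i)) ++ i :: rev (iota 0 i),
                    j' <- rev (iota j.+1 (n - j)) ++ j :: rev (iota 0 j)].
  by rewrite -!rev_split.
have split_pairs (s1 s2 t1 t2 : seq nat) :
    [seq (i', j') | i' <- s1 ++ i :: s2, j' <- t1 ++ j :: t2] =
    ([seq (i', j') | i' <- s1, j' <- t1 ++ j :: t2] ++ [seq (i, j') | j' <- t1]) ++
    (i, j) :: ([seq (i, j') | j' <- t2] ++ [seq (i', j') | i' <- s2, j' <- t1 ++ j :: t2]).
  by rewrite allpairs_cat allpairs_cons map_cat /= -!catA.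
rewrite split_pairs foldl_cat -rev_split //.
(* [P] lists the blocks filled before [(i, j)]; later blocks only add points. *)
set P := _ ++ _; rewrite [foldl _ _ (_ :: _)]/=; apply: mono.
have memP i' j' : ((i', j') \in P) = (i < i' <= n) && (j' <= n) || (i' == i) && (j < j' <= n).
  rewrite /P mem_cat; congr (_ || _).
    apply/allpairsP/idP => [[[a b] [ha hb [-> ->]]]|h].
      by move: ha hb; rewrite !mem_rev !mem_iota /=; lia.
    by exists (i', j'); rewrite !mem_rev !mem_iota; split=> //=; lia.
  apply/mapP/idP => [[b hb [-> ->]]|/andP[/eqP -> h]].
    by move: hb; rewrite mem_rev mem_iota; lia.
  by exists j' => //; rewrite mem_rev mem_iota; lia.
have uP : uniq P.
  rewrite /P cat_uniq; apply/and3P; split.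
  - by rewrite allpairs_uniq ?rev_uniq ?iota_uniq // => -[? ?] [? ?] _ _ [-> ->].
  - apply/hasPn => _ /mapP[b _ ->]; apply/negP => /allpairsP[[a c] [ha _ [e _]]].
    by move: ha e; rewrite mem_rev mem_iota /=; lia.
  - by rewrite map_inj_uniq ?rev_uniq ?iota_uniq // => b b' [].
have bdP : {in P, forall p, (p.1 <= n) && (p.2 <= n)}.
  by move=> [i' j']; rewrite memP /=; lia.
have [R C _] := southeast_points_inv occ uP bdP.
set pts := foldl _ _ P in R C *.
have rowE : row_load n r P i = \sum_(j.+1 <= j' < n.+1) block_points n r i j'.
  rewrite big_geq_mkord; apply: eq_bigl => j'; rewrite memP eqxx ltnn /=.
  by have := ltn_ord j'; lia.
have colE : col_load n r P j = \sum_(i.+1 <= i' < n.+1) block_points n r i' j.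
  rewrite big_geq_mkord; apply: eq_bigl => i'; rewrite memP ltnn andbF orbF hj andbT /=.
  by have := ltn_ord i'; lia.
have Rle : row_load n r P i + block_points n r i j <= r i i.
  rewrite -(sum_row_points occ hi) rowE; apply: leq_trans (leq_addr _ _).
  rewrite -(big_mkord xpredT (block_points n r i)) [leqRHS](big_cat_nat (n := j)) //=; last by lia.
  by rewrite [X in _ <= _ + X]big_ltn; lia.
have Cle : col_load n r P j + block_points n r i j <= r (n - j) (n - j).
  rewrite -(sum_col_points occ hj) colE; apply: leq_trans (leq_addr _ _).
  rewrite -(big_mkord xpredT (fun i => block_points n r i j)).
  rewrite [leqRHS](big_cat_nat (n := i)) //=; last by lia.
  by rewrite [X in _ <= _ + X]big_ltn; lia.
rewrite /fill_block mem_cat; apply/orP; right.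
have := occupied_free R (hi : i < n.+1); rewrite -/(block_row r i) => FR.
have := occupied_free C (hj : j < n.+1); rewrite -/(block_col n r j) => FC.
rewrite /free_rows FR /free_cols FC -rowE -colE.
by apply: mem_zip_rev_iota => //; lia.
Qed.

Lemma diagonal_points_mem i t : i < n -> t < r i i.+1 ->
  (block_row r i + t, block_col n r (n - i.+1) + t) \in zelevinsky_points n r.
Proof.
move=> hi ht; rewrite mem_cat; apply/orP; right; apply/flatten_mapP; exists i.
  by rewrite mem_iota.
pose P := [seq (i, j) | i <- rev (iota 0 n.+1), j <- rev (iota 0 n.+1)].
have memP i' j' : ((i', j') \in P) = (i' <= n) && (j' <= n).
  apply/allpairsP/idP => [[[a b] [ha hb [-> ->]]]|h].
    by move: ha hb; rewrite !mem_rev !mem_iota /=; lia.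
  by exists (i', j'); rewrite !mem_rev !mem_iota; split=> //=; lia.
have uP : uniq P.
  by apply: allpairs_uniq; rewrite ?rev_uniq ?iota_uniq // => -[? ?] [? ?] _ _ [-> ->].
have bdP : {in P, forall p, (p.1 <= n) && (p.2 <= n)}.
  by move=> [i' j']; rewrite memP.
have [[_ m1 _] [_ m2 _] _] := southeast_points_inv occ uP bdP.
have rowE : row_load n r P i + r i i.+1 = r i i.
  have := sum_row_points occ (ltnW hi); rewrite hi => <-; congr (_ + _).
  by apply: eq_bigl => j; rewrite memP (ltnW hi) -ltnS ltn_ord.
have hj : n - i.+1 <= n by lia.
have colE : col_load n r P (n - i.+1) + r i i.+1 = r i.+1 i.+1.
  have := sum_col_points occ hj; rewrite subKn // (_ : n - i.+1 < n) /=; last by lia.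
  move=> <-; congr (_ + _).
  by apply: eq_bigl => j; rewrite memP hj -ltnS ltn_ord.
rewrite mem_filter; apply/andP; split; last first.
  apply/mapP; exists t => //; rewrite mem_iota leq_min; lia.
apply/andP; split.
  by have := m1 i t (ltnW hi); rewrite -/(block_row r i) /= => ->; lia.
by have := m2 (n - i.+1) t hj; rewrite -/(block_col n r (n - i.+1)) subKn //= => ->; lia.
Qed.

Notation d := (total_dim n r).
Notation row_block := (row_block n r).
Notation col_block := (col_block n r).
Notation first_col := (first_col n r).
Notation block_count := (block_count n r).

Variable u : 'S_d.
Hypothesis u_count : forall i k, i <= n -> k <= n ->
  #|[set p : 'I_d | (row_block p == i) && (col_block (u p) == k)]| = block_count i k.
Hypothesis u_mono : forall p p' : 'I_d, p < p' -> u p' < u p ->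
  row_block p < row_block p' /\ col_block (u p) < col_block (u p').

Let row_le (p : 'I_d) : row_block p <= n.
Proof. by have [] := row_blockP (ltn_ord p). Qed.

Let col_le (p : 'I_d) : col_block p <= n.
Proof. by have [] := col_blockP (ltn_ord p). Qed.

Let row_mono (p p' : 'I_d) (le : p <= p') : row_block p <= row_block p' :=
  row_block_mono le (ltn_ord p').

Let col_mono (q q' : 'I_d) (le : q <= q') : col_block q' <= col_block q :=
  col_block_mono le (ltn_ord q').

Let u_row (p p' : 'I_d) : row_block p = row_block p' -> (u p < u p') = (p < p').
Proof.
move=> e; case: (ltngtP p p') => h.
- case: (ltngtP (u p) (u p')) => // [/(u_mono h)|/val_inj /perm_inj ep].
    by rewrite e ltnn => -[].
  by rewrite ep ltnn in h.
- by case: (ltngtP (u p) (u p')) => // /(u_mono h); rewrite e ltnn => -[].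
- by rewrite (val_inj h) ltnn.
Qed.

Let u_col (p p' : 'I_d) : col_block (u p) = col_block (u p') -> (u p < u p') = (p < p').
Proof.
move=> e; case: (ltngtP p p') => h.
- case: (ltngtP (u p) (u p')) => // [/(u_mono h)|/val_inj /perm_inj ep].
    by rewrite e ltnn => -[].
  by rewrite ep ltnn in h.
- by case: (ltngtP (u p) (u p')) => // /(u_mono h); rewrite e ltnn => -[].
- by rewrite (val_inj h) ltnn.
Qed.

(** Since [u] increases inside each block row and block column, the position of a point there is the
    number of points before or after it, which the block counts determine. *)
Lemma graph_mem_zelevinsky_points (p : 'I_d) : (val p, val (u p)) \in zelevinsky_points n r.
Proof.
have transport (a b a' b' : nat) (s : seq (nat * nat)) :
  a = a' -> b = b' -> (a, b) \in s -> (a', b') \in s by move=> -> ->.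
set i := row_block p; set k := col_block (u p).
have hi : i <= n := row_le p; have hk : k <= n := col_le (u p).
have [_ hp] := row_blockP (ltn_ord p); rewrite -/i in hp.
have [_ hu] := col_blockP (ltn_ord (u p)); rewrite -/k in hu.
have hr := block_rowS r i.
have hd := block_row_first_col r hi; have hd' := first_col_end r hk.
pose B i' k' := [set q : 'I_d | (row_block q == i') && (col_block (u q) == k')].
have pB : p \in B i k by rewrite inE !eqxx.
have row_eq (q : 'I_d) : (row_block q == i) = (block_row r i <= q < block_row r i.+1).
  apply/eqP/idP => [<-|]; last exact: row_block_eq.
  by have [] := row_blockP (ltn_ord q).
have col_eq (q : 'I_d) : (col_block q == k) = (first_col k <= q < first_col k + r k k).
  apply/eqP/idP => [<-|]; last exact: col_block_eq.
  by have [] := col_blockP (ltn_ord q).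
have card_col a b : b <= d -> #|[set q : 'I_d | a <= u q < b]| = b - a.
  move=> bd; rewrite -(card_ord_interval a bd) -[RHS](card_preimset _ (@perm_inj _ u)).
  by apply: eq_card => q; rewrite !inE.
case: (leqP k i) => ki.
- rewrite mem_cat; apply/orP; left.
  (* The points of the block southeast of [p], all placed before it. *)
  pose x := #|[set q in B i k | p < q]|.
  have bc : block_points n r i (n - k) = block_count i k by rewrite /block_count ki.
  have hx : x < block_points n r i (n - k).
    rewrite bc -u_count //; apply: proper_card; apply/properP; split.
      by apply/subsetP => q; rewrite inE => /andP[].
    by exists p => //; rewrite inE ltnn andbF.
  have := southeast_points_mem hi (leq_subr k n) hx; rewrite -/(first_col k) subKn //.
  have row : block_row r i.+1 - p.+1 = \sum_((n - k).+1 <= j' < n.+1) block_points n r i j' + x.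
    rewrite -(@card_ord_interval d); last by lia.
    rewrite -(cardsID [set q : 'I_d | col_block (u q) < k]); congr (_ + _).
      rewrite (card_sum_fibers (f := fun q => col_block (u q)) (N := k)); last first.
        by move=> q; rewrite !inE => /andP[].
      rewrite big_nat_rev -{1}[(n - k).+1]add0n big_addn /= big_mkord.
      have -> : n.+1 - (n - k).+1 = k by lia.
      apply: eq_bigr => k' _; have := ltn_ord k' => hk'.
      have -> : (n - k).+1 + n.+1 - (k' + (n - k).+1).+1 = n - k' by lia.
      have -> : block_points n r i (n - k') = block_count i k'.
        by rewrite /block_count ifT //; lia.
      rewrite -u_count; [|lia|lia]; apply: eq_card => q; rewrite !inE row_eq.
      case: (ltngtP p q) => [h|h|/val_inj e]; last 1 first.
      + by rewrite -e -/k; lia.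
      + by lia.
      + have := @col_mono (u q) (u p); rewrite -/k.
        by have := @u_row q p; rewrite -/i => hh; have := row_eq q; lia.
    apply: eq_card => q; rewrite !inE row_eq.
    case: (ltngtP p q) => h; rewrite ?andbF //.
    have := @col_mono (u p) (u q); rewrite -/k.
    by have := @u_row p q; rewrite -/i => hh; have := row_eq q; lia.
  have col : first_col k + r k k - (u p).+1 =
      \sum_(i.+1 <= i' < n.+1) block_points n r i' (n - k) + x.
    rewrite -card_col; last by lia.
    rewrite -(cardsID [set q : 'I_d | i < row_block q]); congr (_ + _).
      rewrite (card_sum_fibers (f := fun q : 'I_d => row_block q) (N := n.+1)); last first.
        by move=> q _; rewrite ltnS.
      rewrite big_geq_mkord [LHS](bigID (fun i' : 'I_n.+1 => i.+1 <= i')) /=.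
      rewrite [X in _ + X]big1 ?addn0; last first.
        by move=> i' hi'; apply/eqP; rewrite cards_eq0; apply/eqP/setP => q; rewrite !inE; lia.
      apply: eq_bigr => i' hi'.
      have -> : block_points n r i' (n - k) = block_count i' k.
        by rewrite /block_count ifT //; lia.
      rewrite -u_count //; last by rewrite -ltnS.
      apply: eq_card => q; rewrite !inE col_eq.
      case: (ltngtP p q) => [h|h|/val_inj e]; last 1 first.
      + by rewrite -e -/i; lia.
      + by have := @u_col p q; rewrite -/k => hh; have := col_eq (u q); lia.
      + by have := row_mono (ltnW h); rewrite -/i; lia.
    apply: eq_card => q; rewrite !inE col_eq.
    case: (ltngtP p q) => [h|h|/val_inj e].
    + have := row_mono (ltnW h); rewrite -/i.
      by have := @u_col p q; rewrite -/k => hh; have := col_eq (u q); lia.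
    + have := @u_col p q; rewrite -/k => hh; have := col_eq (u q); rewrite ?andbF; lia.
    + by rewrite -e; lia.
  by apply: transport => /=; lia.
have ki1 : k = i.+1.
  have : 0 < #|B i k| by apply/card_gt0P; exists p.
  rewrite u_count // /block_count ifF; last by lia.
  by case: eqP.
have hin : i < n by lia.
pose t := #|[set q in B i k | q < p]|.
have ht : t < r i i.+1.
  have -> : r i i.+1 = #|B i k| by rewrite u_count // /block_count ki1 ltnn eqxx.
  apply: proper_card; apply/properP; split.
    by apply/subsetP => q; rewrite inE => /andP[].
  by exists p => //; rewrite inE ltnn andbF.
have := diagonal_points_mem hin ht; rewrite -ki1 -/(first_col k).
(* Nothing lies beyond the superantidiagonal blocks, so in its block row and block column [p] is
   preceded only by points of its own block. *)
have count0 (q : 'I_d) : col_block (u q) <= (row_block q).+1.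
  rewrite leqNgt; apply/negP => h.
  have : 0 < #|B (row_block q) (col_block (u q))| by apply/card_gt0P; exists q; rewrite inE !eqxx.
  by rewrite u_count ?row_le ?col_le // /block_count !ifF //; lia.
have row : p - block_row r i = t.
  rewrite -(@card_ord_interval d); last exact: ltnW.
  apply: eq_card => q; rewrite !inE row_eq.
  case: (ltngtP p q) => h; rewrite ?andbF //; try lia.
  have := @col_mono (u q) (u p); have := count0 q; rewrite -/k.
  by have := @u_row q p; rewrite -/i => hh; have := row_eq q; lia.
have col : u p - first_col k = t.
  rewrite -card_col; last exact: ltnW.
  apply: eq_card => q; rewrite !inE col_eq.
  have := @u_col q p; rewrite -/k => hh; have := col_eq (u q); have := count0 q.
  case: (ltngtP p q) => [h|h|/val_inj e]; rewrite ?andbF; try lia.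
    by have := row_mono (ltnW h); rewrite -/i; lia.
  by rewrite -e; lia.
by apply: transport => /=; lia.
Qed.

Lemma zelevinsky_eq : zelevinsky n r = u.
Proof.
apply/permP => p; have := graph_mem_zelevinsky_points p.
rewrite -(perm_mem (zelevinskyP occ)) => /imageP[q _ [e1 e2]].
by apply: val_inj; rewrite /= e2 (val_inj e1 : p = q).
Qed.

End ZelevinskyPoints.

(** * The injection *)

Section PipeDreamOfLacing.

Variables (n : nat) (r : nat -> nat -> nat).
Hypothesis occ : occur n r.

Notation d := (total_dim n r).

Definition lacing_pipe_dream (W : lacing n r) : pipe_dream d := pipes_of d (cross n r (edge W)).

Lemma WminP W : W \in Wmin n r -> [/\ forall k, partial_perm (W k),
  forall i j : 'I_n.+1, i <= j -> Posz #|laces W i j| = lace_array n r i j &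
  Posz (lacing_length W) = expected_codim n r].
Proof.
rewrite inE => /andP[/andP[/forallP pp /forallP ln] /eqP len]; split=> // i j ij.
by have /forallP /(_ j) /implyP /(_ ij) /eqP := ln i.
Qed.

Lemma lacing_pipe_dream_RC W : W \in Wmin n r -> lacing_pipe_dream W \in RC (zelevinsky n r).
Proof.
case/WminP => pp ln len; set C := cross n r (edge W).
have tri : forall p q, C p q -> p + q + 2 <= d := @cross_triangular n r (edge W).
have lt p : p < d -> column_at d C 0 p < d.
  by move=> hp; rewrite -[column_at _ _ _ _]add0n; apply: column_at_bound => //; rewrite add0n.
pose f (p : 'I_d) : 'I_d := Ordinal (lt p (ltn_ord p)).
have f_inj : injective f.
  move=> p p' /(congr1 val) /= e; apply: val_inj => /=.
  by apply: (column_at_inj tri _ _ e); rewrite add0n.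
pose u := perm f_inj; have uE p : u p = column_at d C 0 p :> nat by rewrite permE.
have count := exit_countE occ pp ln uE.
have card : #|block_inversions u| = #|crosses W| := card_block_inversions occ pp ln uE len.
have sub : block_inversions u \subset [set x : 'I_d * 'I_d | (x.1 < x.2) && (u x.2 < u x.1)].
  apply/subsetP => -[p p']; rewrite !inE /= => /andP[h1 h2]; apply/andP; split.
    rewrite ltnNge; apply/negP => /(row_block_mono (n := n) (r := r)) /(_ (ltn_ord p)).
    by rewrite leqNgt h1.
  rewrite ltnNge; apply/negP => /(col_block_mono (n := n) (r := r)) /(_ (ltn_ord (u p'))).
  by rewrite leqNgt h2.
have le := inversions_le_crosses tri uE.
have E : block_inversions u = [set x : 'I_d * 'I_d | (x.1 < x.2) && (u x.2 < u x.1)].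
  by apply/eqP; rewrite eqEcard sub card.
have -> : zelevinsky n r = u.
  apply: zelevinsky_eq => // p p' h1 h2.
  have : (p, p') \in block_inversions u by rewrite E inE h1 h2.
  by rewrite inE => /andP.
apply: reduced_of_card => //; rewrite -[X in X <= _]card E.
exact: leqnn.
Qed.

(** The two prescribed edges lie on the lines bounding block row [k]. The pipe through the lower one
    meets the upper line exactly once, in column [z], so only [z] has to be compared with vertex
    [s]. *)
Lemma lacing_pipe_dream_maps_to W : W \in Wmin n r -> maps_to (lacing_pipe_dream W) W.
Proof.
case/WminP => pp _ _ k s t.
have Dom := @edge_dom _ _ W; have Fun := edge_fun pp; have Inj := edge_inj pp.
set C := cross n r (edge W).
have tri : forall p q, C p q -> p + q + 2 <= d := @cross_triangular n r (edge W).
have hk := ltn_ord k; have hs := ltn_ord s; have ht := ltn_ord t.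
have kn := ltnW hk.
have dk := block_row_first_col r kn; have dk1 := block_row_first_col r hk.
have rk := block_rowS r k; have rk1 := block_rowS r k.+1.
have fk := first_colE r kn; have wk : width n r k = r k.+1 k.+1 by rewrite /width hk.
have rows i : \sum_(0 <= j < i) r j j = block_row r i by rewrite big_mkord.
have cols i : i <= n.+1 -> \sum_(i <= j < n.+1) r j j = d - block_row r i.
  move=> hi; rewrite -rows /total_dim -(big_mkord xpredT (fun i => r i i)).
  by rewrite [X in _ = X - _](big_cat_nat (n := i)) //= addKn.
set top := (true, block_row r k, vertex_col n r k s).
set bot := (true, block_row r k.+1, vertex_col n r k.+1 t).
have topE b : is_box b (\sum_(0 <= i < k) r i i + 1) (\sum_(k <= i < n.+1) r i i - s.+1 + 1) =
    (grid_coord (top_edge b) == top).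
  rewrite /is_box rows cols ?(leqW kn) //= xpair_eqE xpair_eqE eqxx /=; congr (_ && _).
    by lia.
  by rewrite /vertex_col; lia.
have botE c : is_box c (\sum_(0 <= i < k.+1) r i i) (\sum_(k.+1 <= i < n.+1) r i i - t.+1 + 1) =
    (grid_coord (bottom_edge c) == bot).
  rewrite /is_box rows cols ?(leqW hk) //= xpair_eqE xpair_eqE eqxx /= /bump leq0n add1n.
  congr (_ && _); by rewrite /vertex_col; lia.
set z := rise d C (r k k) (block_row r k) (first_col n r k - t.+1).
have vt : vertex_col n r k.+1 t = first_col n r k - t.+1 by rewrite /vertex_col; lia.
have up : reach d C bot (true, block_row r k, z).
  by rewrite /bot rk vt; apply: (reach_rise tri); lia.
have zs : (z == vertex_col n r k s) = W k s t.
  apply/eqP/idP => [e|]; last by rewrite -edge_ord => /(rise_edge Dom Fun Inj).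
  case: (boolP [exists s', W k s' t]) => [/existsP[s' h]|/existsPn ne].
    have := h; rewrite -edge_ord => /(rise_edge Dom Fun Inj); rewrite -/C -/z e => e'.
    suff -> : s = s' by [].
    by apply: val_inj; have := ltn_ord s'; move: e'; rewrite /vertex_col /=; lia.
  (* Without an edge at [t] the pipe would still be left of [first_col n r k], where no vertex of
     column [k] sits. *)
  have := rise_no_edge Dom Fun Inj hk ht; rewrite -/C -/z e /vertex_col => h.
  suff : first_col n r k.+1 <= first_col n r k + r k k - s.+1 < first_col n r k by lia.
  apply: h => s'; apply/negP => ed; have [_ hs' _] := Dom _ _ _ ed.
  by case/negP: (ne (Ordinal hs')); rewrite -edge_ord.
split=> [[P hP [b [c [/[!topE] /eqP hb /[!botE] /eqP hc bP cP]]]]|].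
  rewrite -zs.
  have [f fz] : exists f : grid_edge d, grid_coord f = (true, block_row r k, z).
    by case: up => _ [f [_ fz _]]; exists f.
  have fP : f \in P by apply: (pipes_closed hP cP); rewrite hc fz.
  have := pipes_reach hP fP bP; rewrite fz hb.
  by case=> /reach_line ->.
rewrite -zs => /eqP e; rewrite e in up.
have d1 : block_row r k < d by lia.
have d2 : vertex_col n r k s < d by rewrite /vertex_col; lia.
have d3 : (block_row r k.+1).-1 < d by lia.
have d4 : vertex_col n r k.+1 t < d by rewrite /vertex_col; lia.
pose b : 'I_d * 'I_d := (Ordinal d1, Ordinal d2).
pose c : 'I_d * 'I_d := (Ordinal d3, Ordinal d4).
have hb : grid_coord (top_edge b) = top by [].
have hc : grid_coord (bottom_edge c) = bot.
  by rewrite /= /bump leq0n add1n prednK //; lia.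
have [P hP cP] := @pipe_edgeP d C (bottom_edge c).
exists P => //; exists b, c; rewrite topE botE hb hc; split=> //.
by apply: (pipes_closed hP cP); rewrite hb hc.
Qed.

End PipeDreamOfLacing.

Theorem theorem1 (n : nat) (r : nat -> nat -> nat)
    (n_ge1 : 1 <= n) (r_occur : occur n r) :
  exists phi : {W : lacing n r | W \in Wmin n r} ->
               {D : pipe_dream (total_dim n r) | D \in RC (zelevinsky n r)},
    injective phi /\ forall W, maps_to (val (phi W)) (val W).
Proof.
exists (fun W => exist (fun D => D \in RC (zelevinsky n r)) (lacing_pipe_dream (val W))
  (lacing_pipe_dream_RC r_occur (valP W))).
have maps (W : {W : lacing n r | W \in Wmin n r}) : maps_to (lacing_pipe_dream (val W)) (val W).
  exact: lacing_pipe_dream_maps_to (valP W).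
split=> [W W' /(congr1 val) /= e|W]; last exact: maps.
(* Being an equivalence, [maps_to] reads every entry of the diagram off the pipe dream, which gives
   injectivity. *)
apply/val_inj/ffunP => k; apply/matrixP => s t.
by apply/idP/idP => [/maps|/maps]; [rewrite e|rewrite -e] => /maps.
Qed.
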